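(* Let $\bar A=(A_0,A_1)$ be a compatible couple of (quasi-)Banach spaces with $A_0\cap A_1\neq\{0\}$. Let $0<\theta_0<\theta_1<1$, $0<\theta<1$, $0<r,r_0,r_1,q_0,q_1\le\infty$, $a,a_0,a_1,b_0,b_1\in SV$, $\left\|s^{-1/r_0}\frac{b_0(s)}{a_0(s)}\right\|_{r_0,(0,1)}<\infty$, and $\left\|s^{-1/r_1}\frac{b_1(s)}{a_1(s)}\right\|_{r_1,(0,1)}<\infty$. Put $c_0(t)=a_0(t)\left\|s^{-1/r_0}\frac{b_0(s)}{a_0(s)}\right\|_{r_0,(0,t)}$, $c_1(t)=a_1(t)\left\|s^{-1/r_1}\frac{b_1(s)}{a_1(s)}\right\|_{r_1,(0,t)}$, and $\rho(t)=t^{\theta_1-\theta_0}\frac{c_0(t)}{c_1(t)}$ for $t>0$. Then $$\left(\bar A^{\mathcal R}_{\theta_0,r_0,b_0,q_0,a_0},\bar A^{\mathcal R}_{\theta_1,r_1,b_1,q_1,a_1}\right)_{\theta,r,a}\cong\bar A_{\eta,r,a^{\#}},$$ where $\eta=(1-\theta)\theta_0+\theta\theta_1$ and $a^{\#}(t)=c_0(t)^{1-\theta}c_1(t)^{\theta}a(\rho(t))$.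
   Context: For a compatible couple $\bar X=(X_0,X_1)$ of (quasi-)Banach spaces, $f\in X_0+X_1$ and $t>0$, $K(t,f)=K(t,f;\bar X)=\inf\{\|f_0\|_{X_0}+t\|f_1\|_{X_1}: f=f_0+f_1,\ f_i\in X_i\}$. $\|\cdot\|_{q,(c,d)}$ ($0<q\le\infty$) is the usual (quasi-)norm of the Lebesgue space $L_q$ on the interval $(c,d)$ with Lebesgue measure (variable of integration: the displayed variable; $1/\infty=0$). $SV$ is the set of positive Lebesgue measurable functions $b$ on $(0,\infty)$ that are slowly varying: for each $\varepsilon>0$, $t^{\varepsilon}b(t)$ is equivalent to an increasing function and $t^{-\varepsilon}b(t)$ is equivalent to a decreasing function, where two positive functions are equivalent if each is bounded by a constant multiple of the other. For $0\le\theta\le1$, $0<q\le\infty$, $b\in SV$, $\bar X_{\theta,q,b}=(X_0,X_1)_{\theta,q,b}$ is the space of $f\in X_0+X_1$ with $\|f\|=\left\|u^{-\theta-1/q}b(u)K(u,f)\right\|_{q,(0,\infty)}<\infty$. For $0<\sigma<1$, $0<r,q\le\infty$, $a,b\in SV$, $\bar X^{\mathcal R}_{\sigma,r,b,q,a}$ is the space of $f\in X_0+X_1$ with $\|f\|=\left\|t^{-1/r}\frac{b(t)}{a(t)}\left\|u^{-\sigma-1/q}a(u)K(u,f)\right\|_{q,(t,\infty)}\right\|_{r,(0,\infty)}<\infty$. $X\cong Y$ means that $X$ and $Y$ are continuously embedded in each other (same space, equivalent quasi-norms). *)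

(* Defs.v *)
From HB Require Import structures.
From mathcomp Require Import all_boot all_order all_algebra.
From mathcomp Require Import all_classical all_reals all_analysis.
From mathcomp Require Import measurable_realfun.

Set Implicit Arguments.
Unset Strict Implicit.
Unset Printing Implicit Defensive.
Import Order.TTheory GRing.Theory Num.Theory.
Import numFieldNormedType.Exports.

Local Open Scope classical_set_scope.
Local Open Scope ring_scope.

(* A quasi-normed space sitting inside an ambient vector space [E]; the values
   of [qnorm] outside of [carrier] carry no information. Complex spaces are
   covered by restriction of scalars, since K-functionals and interpolation
   spaces only involve the additive structure and the quasi-norms. *)
Record qspace (R : realType) (E : lmodType R) := QSpace {
  carrier : set E ;
  qnorm : E -> R
}.

Record quasi_banach (R : realType) (E : lmodType R) (X : qspace E) : Prop := {
  qb_zero : carrier X 0 ;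
  qb_add : forall x y, carrier X x -> carrier X y -> carrier X (x + y) ;
  qb_scale : forall (k : R) x, carrier X x -> carrier X (k *: x) ;
  qb_ge0 : forall x, carrier X x -> 0 <= qnorm X x ;
  qb_definite : forall x, carrier X x -> qnorm X x = 0 -> x = 0 ;
  qb_homogeneous : forall (k : R) x, carrier X x ->
    qnorm X (k *: x) = `|k| * qnorm X x ;
  qb_triangle : exists C : R, forall x y, carrier X x -> carrier X y ->
    qnorm X (x + y) <= C * (qnorm X x + qnorm X y) ;
  qb_complete : forall u : nat -> E, (forall n, carrier X (u n)) ->
    (forall e : R, 0 < e -> exists N : nat, forall m n : nat,
       (N <= m)%N -> (N <= n)%N -> qnorm X (u m - u n) < e) ->
    exists2 l, carrier X l & qnorm X (u n - l) @[n --> \oo] --> (0 : R)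
}.

Definition continuously_included (R : realType) (E : topologicalLmodType R)
    (X : qspace E) : Prop :=
  forall x, carrier X x -> forall U : set E, nbhs x U ->
    exists2 d : R, 0 < d & forall y, carrier X y -> qnorm X (y - x) < d -> U y.

(* [topologicalLmodType] rather than [tvsType]: the latter is locally convex,
   which would exclude genuine quasi-Banach couples such as those of L_p
   spaces with p < 1. *)
Record compatible_couple (R : realType) (E : topologicalLmodType R)
    (X0 X1 : qspace E) : Prop := {
  cc_hausdorff : hausdorff_space E ;
  cc_banach0 : quasi_banach X0 ;
  cc_banach1 : quasi_banach X1 ;
  cc_included0 : continuously_included X0 ;
  cc_included1 : continuously_included X1
}.

Definition same_space (R : realType) (E : lmodType R) (X Y : qspace E) : Prop :=
  carrier X = carrier Y /\
  exists2 C : R, 0 < C & forall f, carrier X f ->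
    qnorm X f <= C * qnorm Y f /\ qnorm Y f <= C * qnorm X f.

Definition sum_carrier (R : realType) (E : lmodType R) (X0 X1 : qspace E)
    : set E :=
  [set f | exists f0 f1, [/\ carrier X0 f0, carrier X1 f1 & f = f0 + f1]].

Definition Kfun (R : realType) (E : lmodType R) (X0 X1 : qspace E)
    (t : R) (f : E) : \bar R :=
  ereal_inf [set x | exists f0 f1,
    [/\ carrier X0 f0, carrier X1 f1, f = f0 + f1
      & x = (qnorm X0 f0 + t * qnorm X1 f1)%:E]].

(* [lebesgue_measure] lives on the Borel sigma-algebra. On a nonnegative
   function the library integral is a supremum over the simple functions below
   it and the essential supremum neglects all subsets of Borel null sets, so
   for a nonnegative Lebesgue measurable function that is not Borel these are
   still the usual values. *)
Definition Lq (R : realType) (q : \bar R) (I : set R) (f : R -> \bar R)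
    : \bar R :=
  Lnorm (@lebesgue_measure R) q (f \_ I).

(* In [\bar R] the inverse of [+oo] is [0], so [rcpr +oo = 0]. *)
Definition rcpr (R : realType) (q : \bar R) : R := fine (q^-1)%E.

(* [completed_algebra_gen] adjoins to the Borel sets all subsets of null Borel
   sets: its elements are the Lebesgue measurable sets. *)
Definition lebesgue_measurable_fun (R : realType) (D : set R) (b : R -> R)
    : Prop :=
  forall Y : set R, measurable Y ->
    completed_algebra_gen (@lebesgue_measure R) (D `&` b @^-1` Y).

Definition equivalent (R : realType) (f g : R -> R) : Prop :=
  exists2 C : R, 0 < C & forall t, 0 < t -> f t <= C * g t /\ g t <= C * f t.

(* Monotonicity is non-strict; a positive nondecreasing function [g] is
   equivalent to the strictly increasing [t |-> g t * (1 + t / (1 + t))]. *)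
Record SV (R : realType) (b : R -> R) : Prop := {
  SV_pos : forall t, 0 < t -> 0 < b t ;
  SV_measurable : lebesgue_measurable_fun `]0, +oo[ b ;
  SV_incr : forall e : R, 0 < e -> exists g : R -> R,
    [/\ forall t, 0 < t -> 0 < g t,
        forall s t, 0 < s -> s <= t -> g s <= g t
      & equivalent (fun t => t `^ e * b t) g] ;
  SV_decr : forall e : R, 0 < e -> exists g : R -> R,
    [/\ forall t, 0 < t -> 0 < g t,
        forall s t, 0 < s -> s <= t -> g t <= g s
      & equivalent (fun t => t `^ (- e) * b t) g]
}.

Section spaces.
Context (R : realType) (E : lmodType R).

(* || u^(-s-1/q) b(u) K(u,f) ||_{q,I} *)
Definition Kweighted (X0 X1 : qspace E) (s : R) (q : \bar R) (b : R -> R)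
    (I : set R) (f : E) : \bar R :=
  Lq q I (fun u => (u `^ (- s - rcpr q) * b u)%:E * Kfun X0 X1 u f)%E.

Definition Kspace (X0 X1 : qspace E) (s : R) (q : \bar R) (b : R -> R)
    : qspace E :=
  {| carrier := [set f | sum_carrier X0 X1 f /\
                         (Kweighted X0 X1 s q b `]0%R, +oo[ f < +oo)%E] ;
     qnorm := fun f => fine (Kweighted X0 X1 s q b `]0, +oo[ f) |}.

Definition Rfunctional (X0 X1 : qspace E) (s : R) (r : \bar R) (b : R -> R)
    (q : \bar R) (a : R -> R) (f : E) : \bar R :=
  Lq r `]0, +oo[ (fun t => (t `^ (- rcpr r) * (b t / a t))%:E *
                           Kweighted X0 X1 s q a `]t, +oo[ f)%E.

Definition Rspace (X0 X1 : qspace E) (s : R) (r : \bar R) (b : R -> R)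
    (q : \bar R) (a : R -> R) : qspace E :=
  {| carrier := [set f | sum_carrier X0 X1 f /\
                         (Rfunctional X0 X1 s r b q a f < +oo)%E] ;
     qnorm := fun f => fine (Rfunctional X0 X1 s r b q a f) |}.

End spaces.

(* || s^(-1/r) b(s)/a(s) ||_{r,I} *)
Definition ratio_norm (R : realType) (r : \bar R) (b a : R -> R) (I : set R)
    : \bar R :=
  Lq r I (fun s => (s `^ (- rcpr r) * (b s / a s))%:E).

(* Main.v *)
(* Write [Y_i] for the two R-spaces, [k(t) = K(t,f;A)] and [KY(t) = K(t,f;Y)].
   Restricting the inner norm of [Y_i] to [(t,2t)] and the outer one to [(0,t)]
   gives [k(t) <= C t^theta_i / c_i(t) |f|_(Y_i)], hence pointwise
   [t^-eta a#(t) k(t) <= C u^-theta a(u) KY(u)] at [u = rho(t)].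

   Conversely, an almost optimal decomposition [f = f0 + f1] for [k(t)]
   satisfies [K(s,f0) <= C k(min(s,t))] and [K(s,f1) <= C min(1,s/t) k(max(s,t))].
   Since the weights vary slowly, [|f0|_(Y_0) + rho(t) |f1|_(Y_1)] is bounded by
   a supremum of [k] against weights decaying geometrically away from [t].
   Thus [u^-theta a(u) KY(u)] is at most [C sup_v h(v) min(u/rho(v),rho(v)/u)^e]
   where [h(v) = v^-eta a#(v) k(v)].

   Both pointwise bounds pass to the norms of [L_r(du/u)] by the same device: the
   supremum is replaced by a sum over the dyadic grid, the kernel has bounded
   norm in [u], and the values of [h] on the grid are dominated by integrals of
   [h]. This replaces the change of variables [u = rho(t)], for which [rho] need
   be neither monotone nor continuous. *)
From HB Require Import structures.
Require Import Defs.
From mathcomp Require Import all_boot all_order all_algebra.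
From mathcomp Require Import all_classical all_reals all_analysis.
From mathcomp Require Import measurable_realfun ess_sup_inf zify ring lra.
Import Order.TTheory GRing.Theory Num.Theory.
Import numFieldNormedType.Exports.
Local Open Scope classical_set_scope.
Local Open Scope ring_scope.

Set Implicit Arguments.
Unset Strict Implicit.
Unset Printing Implicit Defensive.

(** A lower integral is not additive on arbitrary functions. Sums are therefore formed and
    integrated term by term only for explicit measurable functions, namely the kernels and the
    indicators of dyadic blocks; any other function is compared with these or split along a
    measurable set. The weights are known only up to constants and small powers. Each use of slow
    variation costs a factor [expR (e * gap s t)], so every estimate starts with some spare
    exponential decay and divides it: one share pays for slow variation, one makes a norm in [du/u]
    converge, one is passed on. This is the origin of the fractions of [e] and of [theta1 - theta0]
    below. The map [rho] is handled as a coarse bi-Lipschitz map in logarithmic coordinates. One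
    transfer lemma serves both embeddings: the kernel is centred at the values of [rho] on the grid
    in one direction, and at chosen preimages of the grid cells in the other. *)

(** * Integrals without measurability *)

(* The library integral of a nonnegative function is a lower integral, so the
   following rules need no measurability; weights and K-functionals are only ever
   compared with measurable functions, never proved measurable. *)
Section integral_without_measurability.
Context d (T : measurableType d) (R : realType).
Variable mu : {measure set T -> \bar R}.
Local Open Scope ereal_scope.
Import HBNNSimple.

(** A simple function below [f], divided by [c], is a simple function below [g], so the two suprema
    compare directly. *)
Lemma le_integralZl (c : R) (f g : T -> \bar R) : (0 < c)%R ->
  (forall x, 0 <= f x) -> (forall x, 0 <= g x) ->
  (forall x, f x <= c%:E * g x) ->
  \int[mu]_x f x <= c%:E * \int[mu]_x g x.
Proof.
move=> c0 f0 g0 fg; rewrite !ge0_integralTE//.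
apply: ge_ereal_sup => _ [h /= hf <-].
have ci0 : (0 <= c^-1)%R by rewrite invr_ge0 ltW.
rewrite -lee_pdivrMl//.
rewrite -sintegralrM.
rewrite (_ : (_ \* _)%R = scale_nnsfun h ci0)//.
apply: ereal_sup_ubound; exists (scale_nnsfun h ci0) => //= x.
by rewrite EFinM lee_pdivrMl// (le_trans (hf x)).
Qed.

Lemma le_integral_ge0 (f g : T -> \bar R) :
  (forall x, 0 <= f x) -> (forall x, f x <= g x) ->
  \int[mu]_x f x <= \int[mu]_x g x.
Proof.
move=> f0 fg; rewrite -[leRHS]mul1e; apply: le_integralZl => // x.
  exact: le_trans (fg x).
by rewrite mul1e.
Qed.

(** Subadditivity survives here because the cut is measurable: the restrictions of a simple function
    to [A] and to its complement are again simple. *)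
Lemma le_integral_setUC (A : set T) (f : T -> \bar R) : measurable A ->
  (forall x, 0 <= f x) ->
  \int[mu]_x f x <= \int[mu]_x (f \_ A) x + \int[mu]_x (f \_ (~` A)) x.
Proof.
move=> mA f0.
have fA0 B x : 0 <= (f \_ B) x by rewrite /patch; case: ifP.
rewrite !ge0_integralTE//.
apply: ge_ereal_sup => _ [h /= hf <-].
have mAc : measurable (~` A) by exact: measurableC.
rewrite (eq_sintegral (proj_nnsfun h mA \+ proj_nnsfun h mAc)%R); last first.
  move=> x /=; rewrite /mindic !indicE -mulrDr in_setC.
  by case: (x \in A); rewrite /= ?addr0 ?add0r mulr1.
rewrite sintegralD//; apply: leeD.
  apply: ereal_sup_ubound; exists (proj_nnsfun h mA) => //= x.
  rewrite /mindic indicE /patch; case: (x \in A) => /=; first by rewrite mulr1.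
  by rewrite mulr0.
apply: ereal_sup_ubound; exists (proj_nnsfun h mAc) => //= x.
rewrite /mindic indicE /patch; case: (x \in ~` A) => /=; first by rewrite mulr1.
by rewrite mulr0.
Qed.

End integral_without_measurability.

(** * Calculus of the quasi-norms of [L_q] *)

Section Lq_calculus.
Context (R : realType).
Local Open Scope ereal_scope.
Local Notation mu := (@lebesgue_measure R).
Implicit Types (q : \bar R) (f g F G : R -> \bar R) (I J : set R).

Lemma lebesgue_setT_gt0 : 0 < mu [set: R].
Proof.
have -> : [set: R] = [set` `]-oo, +oo[%R] by rewrite set_itvE.
by rewrite lebesgue_measure_itv /= ltry.
Qed.

Lemma Lq_EFin (p : R) I f :
  Lq p%:E I f = (\int[mu]_x (`|(f \_ I) x| `^ p)) `^ p^-1.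
Proof. by rewrite /Lq unlock. Qed.

Lemma Lq_y I f : Lq +oo I f = ess_sup mu (abse \o (f \_ I)).
Proof. by rewrite /Lq unlock lebesgue_setT_gt0. Qed.

Lemma Lq_ge0 q I f : 0 <= Lq q I f.
Proof. exact: Lnorm_ge0. Qed.

Lemma le_poweR (r : R) (x y : \bar R) : (0 <= r)%R -> 0 <= x -> x <= y ->
  x `^ r <= y `^ r.
Proof.
move=> r0 x0 xy; apply: gt0_ler_poweR => //; rewrite in_itv /= ?leey ?andbT//.
exact: le_trans xy.
Qed.

Lemma Lq_le q I J (c : R) f g : 0 < q -> (0 < c)%R -> I `<=` J ->
  (forall u, I u -> 0 <= f u) -> (forall u, J u -> 0 <= g u) ->
  (forall u, I u -> f u <= c%:E * g u) ->
  Lq q I f <= c%:E * Lq q J g.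
Proof.
move=> q0 c0 IJ f0 g0 fg.
have H x : `|(f \_ I) x| <= c%:E * `|(g \_ J) x|.
  rewrite /patch; case: ifPn => [|_]; last first.
    by rewrite abse0 mule_ge0 ?abse_ge0 ?lee_fin ?(ltW c0).
  rewrite inE => Ix; rewrite mem_set; last exact: IJ.
  rewrite !gee0_abs ?f0 ?fg//; apply: g0; exact: IJ.
case: q q0 => [p||//].
- rewrite lte_fin => p0; rewrite !Lq_EFin.
  have pi0 : (0 <= p^-1)%R by rewrite invr_ge0 ltW.
  have -> : c%:E = (c%:E `^ p) `^ p^-1.
    by rewrite -poweRrM mulfV ?gt_eqF// poweRe1// lee_fin ltW.
  rewrite -poweRM ?poweR_ge0//; last by apply: integral_ge0 => x _; exact: poweR_ge0.
  apply: le_poweR => //; first by apply: integral_ge0 => x _; exact: poweR_ge0.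
  apply: le_integralZl => //; first exact: powR_gt0.
  + by move=> x; exact: poweR_ge0.
  + by move=> x; exact: poweR_ge0.
  + move=> x; rewrite -poweR_EFin -poweRM ?lee_fin ?abse_ge0 ?(ltW c0)//.
    by apply: le_poweR => //; rewrite ?abse_ge0// ltW.
- move=> _; rewrite !Lq_y -ess_sup_pZl//.
  by apply: le_ess_sup; apply: nearW => x /=.
Qed.

Lemma Lq_setU q (I I1 I2 : set R) f : 0 < q -> measurable I1 ->
  I1 `<=` I -> I `<=` I1 `|` I2 ->
  (forall u, (I1 `|` I2) u -> 0 <= f u) ->
  Lq q I f <= (2 `^ fine q^-1)%:E * (Lq q I1 f + Lq q I2 f).
Proof.
move=> q0 mI1 I1I II12 f0.
have fI x : I x -> 0 <= f x by move=> /II12; exact: f0.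
have le1 x : x \in I1 -> `|(f \_ I) x| = `|(f \_ I1) x|.
  by rewrite inE => h; rewrite /patch !mem_set//; exact: I1I.
have le2 x : x \notin I1 -> `|(f \_ I) x| <= `|(f \_ I2) x|.
  move=> h; rewrite /patch; case: ifPn => [|_]; last by rewrite abse0 abse_ge0.
  rewrite inE => Ix; rewrite mem_set//; case: (II12 _ Ix) => // /mem_set.
  by rewrite (negbTE h).
case: q q0 => [p||//].
- rewrite lte_fin => p0; rewrite !Lq_EFin /= inver gt_eqF//=.
  have pi0 : (0 <= p^-1)%R by rewrite invr_ge0 ltW.
  set X1 := \int[mu]_x (`|(f \_ I1) x| `^ p).
  set X2 := \int[mu]_x (`|(f \_ I2) x| `^ p).
  have X10 : 0 <= X1 by apply: integral_ge0 => x _; exact: poweR_ge0.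
  have X20 : 0 <= X2 by apply: integral_ge0 => x _; exact: poweR_ge0.
  have le12 : \int[mu]_x (`|(f \_ I) x| `^ p) <= X1 + X2.
    pose g x := `|(f \_ I) x| `^ p.
    have g0 x : 0 <= g x by exact: poweR_ge0.
    apply: (le_trans (le_integral_setUC mu mI1 g0)).
    apply: leeD; apply: le_integral_ge0 => x.
    + by rewrite {1}/patch; case: ifP => // _; exact: poweR_ge0.
    + by rewrite {1}/patch; case: ifPn => [h|_]; rewrite ?poweR_ge0// /g le1.
    + by rewrite {1}/patch; case: ifP => // _; exact: poweR_ge0.
    + rewrite {1}/patch; case: ifPn => [|_]; last exact: poweR_ge0.
      by rewrite in_setC => /le2 h; apply: le_poweR; rewrite ?abse_ge0// ltW.
  have gen Y1 Y2 : 0 <= Y1 -> Y1 <= Y2 ->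
      (Y1 + Y2) `^ p^-1 <= (2 `^ p^-1)%:E * Y2 `^ p^-1.
    move=> Y10 Y12; have Y20 := le_trans Y10 Y12.
    rewrite -poweR_EFin -poweRM ?lee_fin//; apply: le_poweR => //.
      exact: adde_ge0.
    by rewrite mule_natl mule2n leeD2r.
  have c0 : (0 <= 2 `^ p^-1 :> R)%R by exact: powR_ge0.
  apply: (@le_trans _ _ ((X1 + X2) `^ p^-1)).
    apply: le_poweR => //; apply: integral_ge0 => x _; exact: poweR_ge0.
  have [le|/ltW le] := leP X1 X2.
    apply: (le_trans (gen _ _ X10 le)).
    by apply: lee_wpmul2l; rewrite ?lee_fin//; apply: leeDr; exact: poweR_ge0.
  rewrite addeC; apply: (le_trans (gen _ _ X20 le)).
  by apply: lee_wpmul2l; rewrite ?lee_fin//; apply: leeDl; exact: poweR_ge0.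
- move=> _; rewrite invey /= powRr0 mul1e !Lq_y.
  have E1 : (abse \o f \_ I) = fun x => `|(f \_ I) x| by [].
  apply: le_trans (ess_supD _ _ _).
  apply: le_ess_sup; apply: nearW => x /=.
  have [/le1->|/le2 h] := boolP (x \in I1); first by rewrite leeDl.
  by apply: (le_trans h); rewrite leeDr.
Qed.

End Lq_calculus.

(* Logarithmic distance: factors [max(s/t,t/s)^e] become [expR (e * gap s t)], and
   estimates on weights become linear inequalities between logarithms. *)
Definition gap (R : realType) (s t : R) : R := `|ln s - ln t|.

Section gap.
Context (R : realType).
Implicit Types s t u : R.

Lemma gap_ge0 s t : 0 <= gap s t. Proof. exact: normr_ge0. Qed.

Lemma gapC s t : gap s t = gap t s. Proof. exact: distrC. Qed.

Lemma gapxx s : gap s s = 0. Proof. by rewrite /gap subrr normr0. Qed.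

Lemma gap_triangle s t u : gap s u <= gap s t + gap t u.
Proof. exact: ler_distD. Qed.

Lemma gap_le_ln2 s t : 0 < s -> 0 < t -> s <= 2 * t -> t <= 2 * s ->
  gap s t <= ln 2.
Proof.
move=> s0 t0 st ts; have h (x y : R) : 0 < x -> 0 < y -> x <= 2 * y -> ln x <= ln 2 + ln y.
  by move=> x0 y0 xy; rewrite -lnM ?posrE// ler_ln ?posrE ?mulr_gt0.
have := h _ _ s0 t0 st; have := h _ _ t0 s0 ts.
by rewrite /gap ler_norml => h1 h2; apply/andP; split; lra.
Qed.

Lemma gap_double s t : 0 < s -> s <= t -> t <= 2 * s -> gap s t <= ln 2.
Proof.
move=> s0 st ts; have t0 : 0 < t by exact: lt_le_trans st.
by apply: gap_le_ln2 => //; lra.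
Qed.

End gap.

(** * Powers of 2 as a grid on the half-line *)

Section dyadic_grid.
Context (R : realType).

(** A bijection onto the integers, so that the two-sided grid is indexed by [nat] and sums over it
    are ordinary series. *)
Definition int_of_nat (n : nat) : int := if odd n then - (n./2.+1)%:Z else n./2%:Z.

Lemma int_of_nat_inj : injective int_of_nat.
Proof.
move=> m n; rewrite /int_of_nat => h.
rewrite -(odd_double_half m) -(odd_double_half n) -!mul2n; move: h.
move: m./2 n./2 => a b; case: (odd m); case: (odd n) => /= h; lia.
Qed.

Lemma int_of_nat_surj z : exists n, int_of_nat n = z.
Proof.
case: z => n.
- by exists n.*2; rewrite /int_of_nat odd_double doubleK.
- by exists n.*2.+1; rewrite /int_of_nat /= odd_double /= uphalf_double NegzE.
Qed.

Definition grid (n : nat) : R := expR ((int_of_nat n)%:~R * ln 2).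

Lemma grid_gt0 n : 0 < grid n. Proof. exact: expR_gt0. Qed.

Let ln2_gt0 : 0 < ln 2 :> R. Proof. by rewrite ln_gt0// ltr1n. Qed.

Lemma gridP n u : 0 < u ->
  (grid n <= u < 2 * grid n) = (Num.floor (ln u / ln 2) == int_of_nat n).
Proof.
move=> u0; rewrite floor_eq /grid.
have e2 x : 2 * expR x = expR (ln 2 + x) by rewrite expRD lnK// posrE.
rewrite e2 -{1 2}(@lnK _ u)// ler_expR ltr_expR.
rewrite ler_pdivlMr// ltr_pdivrMr// intrD mulrDl mul1r.
by rewrite [X in _ < X]addrC.
Qed.

Lemma grid_cover u : 0 < u -> exists n, grid n <= u < 2 * grid n.
Proof.
move=> u0; have [n nE] := int_of_nat_surj (Num.floor (ln u / ln 2)).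
by exists n; rewrite gridP// nE.
Qed.

Lemma grid_unique m n u : grid m <= u < 2 * grid m ->
  grid n <= u < 2 * grid n -> m = n.
Proof.
move=> hm; have u0 : 0 < u.
  by move/andP: hm => [+ _]; apply: lt_le_trans; exact: grid_gt0.
by move: hm; rewrite !gridP// => /eqP -> /eqP /int_of_nat_inj.
Qed.

End dyadic_grid.

(** * Dyadic averages and exponential kernels in [du/u] *)

Section log_integrals.
Context (R : realType).
Local Open Scope ereal_scope.
Local Notation mu := (@lebesgue_measure R).

(** The endpoint types are free because open, half-open and closed blocks all occur later. *)
Lemma integral_dyadic b1 b2 (l : R) : (0 < l)%R ->
  \int[mu]_x (l^-1 * \1_([set` Interval (BSide b1 l) (BSide b2 (2 * l)%R)]) x)%:E = 1.
Proof.
move=> l0; under eq_integral do rewrite EFinM.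
rewrite ge0_integralZl_EFin//; last 2 first.
- exact/measurable_EFinP/measurable_indic.
- by rewrite invr_ge0 ltW.
rewrite integral_indic// setIT [X in _ * X](@lebesgue_measure_itv R) /= lte_fin.
rewrite ifT; last by lra.
rewrite -EFinD -EFinM; congr EFin; field; lra.
Qed.

Lemma nneseries_single (f : nat -> \bar R) n : 0 <= f n ->
  (forall k, k != n -> f k = 0) -> \sum_(k <oo) f k = f n.
Proof.
move=> fn0 f0; rewrite (@nneseriesD1 _ _ n)//; last first.
  by move=> k _; have [->//|/f0->] := eqVneq k n.
by rewrite eseries0 ?adde0// => k _ /= /f0.
Qed.

Lemma nneseries_geometric_le (q : R) : (0 < q < 1)%R ->
  \sum_(n <oo) (q ^+ n)%:E <= ((1 - q)^-1)%:E.
Proof.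
move=> /andP[q0 q1]; apply: lime_le.
  by apply: is_cvg_nneseries => n _ _; rewrite lee_fin exprn_ge0// ltW.
apply: nearW => n; rewrite sumEFin lee_fin.
have := @geometric_le_lim _ n 1 q ler01 q0.
rewrite ger0_norm ?(ltW q0)// => /(_ q1); rewrite mul1r.
by rewrite -exprn_geometric /series /= big_mkord.
Qed.

Lemma le_nneseries_term (f : nat -> \bar R) n : (forall k, 0 <= f k) ->
  f n <= \sum_(k <oo) f k.
Proof.
move=> f0; rewrite (@nneseriesD1 _ _ n)// leeDl//.
exact: nneseries_ge0.
Qed.

Lemma measurable_log_kernel (e c : R) :
  measurable_fun [set: R] (fun u : R => (expR (- ln u - e * `|ln u - c|))%:E).
Proof.
apply/measurable_EFinP; apply: measurableT_comp => //.
apply: measurable_funB; first exact: measurableT_comp.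
apply: measurable_funM => //; apply: measurableT_comp => //.
exact: measurable_funB.
Qed.

(** On the [n]-th dyadic block to the right or to the left of [t] the kernel is at most [q ^+ n]
    with [q = 2^-e], and [1/u] is at most the inverse of the left endpoint. Each block thus
    contributes at most [q ^+ n], and two geometric series give the constant. *)
Lemma log_kernel_integral (e : R) : (0 < e)%R -> exists2 C : R, (0 < C)%R &
  forall t, (0 < t)%R ->
  \int[mu]_u ((fun u => (expR (- ln u - e * gap u t))%:E)
               \_ [set` `]0%R, +oo[%R]) u <= C%:E.
Proof.
move=> e0; set q := expR (- (e * ln 2)).
have ln20 : (0 < ln 2 :> R)%R by rewrite ln_gt0// ltr1n.
have q01 : (0 < q < 1)%R by rewrite expR_gt0 expR_lt1 oppr_lt0 mulr_gt0.
have [q0 q1] := andP q01.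
exists (2 * (1 - q)^-1)%R; first by rewrite mulr_gt0// invr_gt0 subr_gt0.
move=> t t0.
pose h l (u : R) := (l^-1 * \1_([set` `[l, 2 * l]%R]) u : R)%R.
pose l n := (t * expR (n%:R * ln 2))%R.
pose m n := (t * expR (- (n.+1%:R * ln 2)))%R.
have l0 n : (0 < l n)%R by rewrite mulr_gt0// expR_gt0.
have m0 n : (0 < m n)%R by rewrite mulr_gt0// expR_gt0.
have h0 x u : (0 < x)%R -> (0 <= h x u)%R.
  by move=> x0; rewrite mulr_ge0 ?invr_ge0 ?(ltW x0)// indicE.
pose g n (u : R) := (q ^+ n)%:E * ((h (l n) u)%:E + (h (m n) u)%:E).
have qn0 n : (0 <= q ^+ n)%R by rewrite exprn_ge0// ltW.
have g0 n u : 0 <= g n u.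
  by rewrite mule_ge0 ?lee_fin// addr_ge0// h0.
have hE x u : (0 < x)%R -> (0 < u)%R -> (ln x <= ln u <= ln x + ln 2)%R ->
    (expR (- ln u) <= h x u)%R.
  move=> x0 u0 /andP[h1 h2]; rewrite /h indicE mem_set ?mulr1; last first.
    rewrite /= in_itv /= -ler_ln ?posrE// h1 /= -ler_ln ?posrE ?mulr_gt0//.
    by rewrite lnM ?posrE// addrC.
  by rewrite -[X in (_ <= X^-1)%R](@lnK _ x)// -expRN ler_expR lerN2.
have qE (n : nat) u : (n%:R * ln 2 <= gap u t)%R ->
    (expR (- (e * gap u t)) <= q ^+ n)%R.
  move=> hn; rewrite /q -expRM_natl ler_expR mulrN lerN2 mulrCA.
  by rewrite ler_pM2l.
have lnl n : ln (l n) = (ln t + n%:R * ln 2)%R.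
  by rewrite lnM ?posrE ?expR_gt0// expRK.
have lnm n : ln (m n) = (ln t - n.+1%:R * ln 2)%R.
  by rewrite lnM ?posrE ?expR_gt0// expRK.
have fg u : ((fun u => (expR (- ln u - e * gap u t))%:E)
    \_ [set` `]0%R, +oo[%R]) u <= \sum_(n <oo) g n u.
  rewrite /patch; case: ifPn => [|_]; last exact: nneseries_ge0.
  (* It suffices to find the block containing [u]: the other terms of the series are nonnegative. *)
  rewrite inE /= in_itv /= andbT => u0.
  suff [n hn] : exists n, ((n%:R * ln 2 <= gap u t) /\
      (expR (- ln u) <= h (l n) u + h (m n) u))%R.
    apply: (le_trans _ (@le_nneseries_term (g ^~ u) n _)) => //.
    rewrite /g -EFinD -EFinM lee_fin addrC expRD; case: hn => hn1 hn2.
    by apply: ler_pM; rewrite ?expR_ge0// qE.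
  have [tu|/ltW ut] := leP (ln t) (ln u).
    pose y := ((ln u - ln t) / ln 2)%R.
    have y0 : (0 <= y)%R by rewrite divr_ge0 ?(ltW ln20)// subr_ge0.
    have yE : (ln u - ln t = y * ln 2)%R by rewrite divfK// gt_eqF.
    have /andP[n1 n2] := truncn_itv y0.
    exists (Num.truncn y); rewrite /gap ger0_norm ?subr_ge0// yE ler_pM2r//.
    split => //; apply: ler_wpDr; first exact: h0.
    apply: hE => //; rewrite lnl.
    have n1' : ((Num.truncn y)%:R * ln 2 <= y * ln 2)%R by rewrite ler_pM2r.
    have : (y * ln 2 < (Num.truncn y).+1%:R * ln 2)%R by rewrite ltr_pM2r.
    rewrite -[(Num.truncn y).+1%:R]natr1 mulrDl mul1r => n2'.
    by apply/andP; split; lra.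
  pose y := ((ln t - ln u) / ln 2)%R.
  have y0 : (0 <= y)%R by rewrite divr_ge0 ?(ltW ln20)// subr_ge0.
  have yE : (ln t - ln u = y * ln 2)%R by rewrite divfK// gt_eqF.
  have /andP[n1 n2] := truncn_itv y0.
  exists (Num.truncn y); rewrite gapC /gap ger0_norm ?subr_ge0// yE ler_pM2r//.
  split => //.
  have n1' : ((Num.truncn y)%:R * ln 2 <= y * ln 2)%R by rewrite ler_pM2r.
  have n2' : (y * ln 2 < (Num.truncn y).+1%:R * ln 2)%R by rewrite ltr_pM2r.
  apply: ler_wpDl; first exact: h0.
  apply: hE => //; rewrite lnm.
  by move: n2'; rewrite -[(Num.truncn y).+1%:R]natr1 mulrDl mul1r => n2'; apply/andP; split; lra.
apply: le_trans; first apply: (le_integral_ge0 mu _ fg).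
  by move=> u; rewrite /patch; case: ifP => // _; rewrite lee_fin expR_ge0.
have mh x : measurable_fun [set: R] (fun u => (h x u)%:E).
  apply/measurable_EFinP; apply: measurable_funM => //.
have mhh n : measurable_fun [set: R] (fun u => (h (l n) u)%:E + (h (m n) u)%:E).
  exact: emeasurable_funD.
have mg n : measurable_fun [set: R] (g n).
  by apply: emeasurable_funM.
rewrite integral_nneseries//.
have E n : \int[mu]_u g n u = 2%:E * (q ^+ n)%:E.
  have hh0 u : [set: R] u -> 0 <= (h (l n) u)%:E + (h (m n) u)%:E.
    by move=> _; rewrite adde_ge0// lee_fin h0.
  rewrite /g (ge0_integralZl_EFin mu measurableT hh0 (mhh n) (qn0 n)).
  have hx0 x : (0 < x)%R -> forall u, [set: R] u -> 0 <= (h x u)%:E.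
    by move=> x0 u _; rewrite lee_fin h0.
  rewrite (ge0_integralD mu measurableT (hx0 _ (l0 n)) (mh _) (hx0 _ (m0 n)) (mh _)).
  by rewrite !integral_dyadic// -EFinD -!EFinM mulrC.
rewrite (eq_eseriesr (fun n _ => E n)).
rewrite nneseriesZl//; last by move=> n _; rewrite lee_fin.
rewrite EFinM; apply: lee_wpmul2l => //; exact: nneseries_geometric_le.
Qed.

End log_integrals.

(* Norm of [L_q(I, du/u)]. *)
Definition Llog (R : realType) (q : \bar R) (I : set R) (F : R -> \bar R) : \bar R :=
  Lq q I (fun u => (u `^ (- rcpr q))%:E * F u)%E.

Section Llog_calculus.
Context (R : realType).
Local Open Scope ereal_scope.
Local Notation mu := (@lebesgue_measure R).
Implicit Types (q : \bar R) (I J : set R).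
Local Notation pos := [set` `]0%R, +oo[%R].

Lemma Llog_ge0 q I F : 0 <= Llog q I F.
Proof. exact: Lq_ge0. Qed.

Lemma Llog_le q I J (c : R) F G : 0 < q -> (0 < c)%R -> I `<=` J ->
  (forall u, I u -> 0 <= F u) -> (forall u, J u -> 0 <= G u) ->
  (forall u, I u -> F u <= c%:E * G u) ->
  Llog q I F <= c%:E * Llog q J G.
Proof.
move=> q0 c0 IJ F0 G0 FG; apply: Lq_le => // u Iu.
- by rewrite mule_ge0 ?lee_fin ?powR_ge0 ?F0.
- by rewrite mule_ge0 ?lee_fin ?powR_ge0 ?G0.
- by rewrite muleCA lee_wpmul2l ?lee_fin ?powR_ge0 ?FG.
Qed.

Lemma Llog_setU q (I I1 I2 : set R) F : 0 < q -> measurable I1 ->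
  I1 `<=` I -> I `<=` I1 `|` I2 ->
  (forall u, (I1 `|` I2) u -> 0 <= F u) ->
  Llog q I F <= (2 `^ fine q^-1)%:E * (Llog q I1 F + Llog q I2 F).
Proof.
move=> q0 mI1 I1I II12 F0; apply: Lq_setU => // u Iu.
by rewrite mule_ge0 ?lee_fin ?powR_ge0 ?F0.
Qed.

Lemma Llog_EFin (p : R) I F : (0 < p)%R -> I `<=` pos ->
  (forall u, I u -> 0 <= F u) ->
  Llog p%:E I F =
  (\int[mu]_u ((fun u => (expR (- ln u))%:E * F u `^ p) \_ I) u) `^ p^-1.
Proof.
move=> p0 I0 F0; rewrite /Llog Lq_EFin; congr (_ `^ _).
apply: eq_integral => u _; rewrite /patch; case: ifPn => [|_]; last first.
  by rewrite abse0 poweR0r// gt_eqF.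
rewrite inE => Iu; have := I0 _ Iu; rewrite /= in_itv /= andbT => u0.
rewrite gee0_abs ?mule_ge0 ?lee_fin ?powR_ge0 ?F0//.
rewrite poweRM ?lee_fin ?powR_ge0 ?F0// poweR_EFin -powRrM /rcpr inver gt_eqF//=.
by rewrite mulNr mulVf ?gt_eqF// /powR gt_eqF// mulN1r.
Qed.

Lemma Llog_y I F : (forall u, I u -> 0 <= F u) ->
  Llog +oo I F = ess_sup mu (F \_ I).
Proof.
move=> F0; rewrite /Llog Lq_y; congr ess_sup; apply/funext => u /=.
rewrite /patch; case: ifPn => [|_]; last by rewrite abse0.
by rewrite inE => Iu; rewrite /rcpr invey /= oppr0 powRr0 mul1e gee0_abs ?F0.
Qed.

Lemma Llog_dyadic q : 0 < q -> exists2 k : R, (0 < k)%R &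
  forall t, (0 < t)%R -> k%:E <= Llog q [set` `]t, (2 * t)[%R] (fun=> 1).
Proof.
case: q => [p||//].
(* The block has length [t] and [1/u] exceeds [1/(2t)] on it, so its mass for [du/u] is at least
   1/2. *)
- rewrite lte_fin => p0; exists (2^-1 `^ p^-1)%R; first by rewrite powR_gt0.
  move=> t t0; rewrite Llog_EFin//; last first.
    move=> u /=; rewrite !in_itv /= andbT => /andP[tu _]; exact: lt_trans tu.
  rewrite -poweR_EFin; apply: le_poweR => //.
    by rewrite invr_ge0 ltW.
  rewrite -(@lee_pmul2l _ 2)// -EFinM divff//.
  rewrite -[leLHS](integral_dyadic false true t0).
  apply: le_integralZl => //.
  + by move=> u; rewrite lee_fin mulr_ge0 ?invr_ge0 ?(ltW t0)// indicE.
  + by move=> u; rewrite /patch; case: ifP => // _; rewrite mule_ge0 ?lee_fin ?expR_ge0 ?poweR_ge0.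
  + move=> u; rewrite indicE /patch; case: ifPn => [|_]; last by rewrite mulr0 mule0.
    rewrite inE /= in_itv /= => /andP[tu ut].
    have u0 : (0 < u)%R by exact: lt_trans tu.
    rewrite ?poweR1r ?powR1 mule1 mulr1 -EFinM lee_fin expRN lnK ?posrE//.
    by rewrite ler_pdivlMr// mulrC ler_pdivrMr// ltW.
- move=> _; exists 1%R => // t t0; rewrite Llog_y//.
  rewrite leNgt; apply/negP => lt1.
  pose g : R -> \bar R := (fun=> 1) \_ [set` `]t, (2 * t)[%R].
  have : \forall x \ae mu, g x < 1.
    have := ess_sup_ge mu g; apply: filterS => x.
    by move/le_lt_trans; apply.
  move=> [N [mN N0 sN]].
  have : mu [set` `]t, (2 * t)[%R] <= mu N.
    apply: le_measure; rewrite ?inE//=.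
    move=> x tx; apply: sN => /=; rewrite /g /patch mem_set//.
    by rewrite ltxx.
  rewrite N0 lebesgue_measure_itv /= lte_fin ifT; last by lra.
  by rewrite -EFinD lee_fin; apply/negP; rewrite -ltNge; lra.
Qed.

(** The way back from norms to values: a lower bound for [F] on a single dyadic block is controlled
    by the norm, with a constant independent of the block. *)
Lemma Llog_lower_bound q : 0 < q -> exists2 C : R, (0 < C)%R &
  forall t I F (g : R), (0 < t)%R -> [set` `]t, (2 * t)[%R] `<=` I ->
  (forall u, I u -> 0 <= F u) ->
  (forall u, (t < u < 2 * t)%R -> g%:E <= F u) ->
  g%:E <= C%:E * Llog q I F.
Proof.
move=> q0; have [k k0 hk] := Llog_dyadic q0.
exists k^-1%R; first by rewrite invr_gt0.
move=> t I F g t0 tI F0 gF.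
have [g0|g0] := leP g 0%R.
  apply: (@le_trans _ _ 0); first by rewrite lee_fin.
  by rewrite mule_ge0 ?Llog_ge0// lee_fin invr_ge0 ltW.
rewrite lee_pdivlMl// muleC -lee_pdivlMl//.
apply: (le_trans (hk _ t0)); apply: Llog_le; rewrite ?invr_gt0//.
move=> u; rewrite /= in_itv /= => /gF.
by rewrite lee_pdivlMl// mule1.
Qed.

Lemma Llog_gap q (e : R) : 0 < q -> (0 < e)%R -> exists2 C : R, (0 < C)%R &
  forall t, (0 < t)%R -> Llog q pos (fun u => (expR (- (e * gap u t)))%:E) <= C%:E.
Proof.
move=> + e0; case: q => [p||//].
- rewrite lte_fin => p0; have [C C0 hC] := log_kernel_integral (mulr_gt0 p0 e0).
  exists (C `^ p^-1)%R; first exact: powR_gt0.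
  move=> t t0; rewrite Llog_EFin//.
  rewrite -poweR_EFin; apply: le_poweR.
  + by rewrite invr_ge0 ltW.
  + apply: integral_ge0 => u _; rewrite /patch; case: ifP => // _.
    by rewrite mule_ge0 ?poweR_ge0 ?lee_fin ?expR_ge0.
  + apply: le_trans (hC _ t0); apply: le_integral_ge0 => u.
      rewrite /patch; case: ifP => // _.
      by rewrite mule_ge0 ?poweR_ge0 ?lee_fin ?expR_ge0.
    rewrite /patch; case: ifP => // _.
    rewrite poweR_EFin -EFinM lee_fin expRD ler_pM2l ?expR_gt0//.
    rewrite {1}/powR gt_eqF ?expR_gt0// expRK.
    by rewrite mulrN mulrA.
- move=> _; exists 1%R => // t t0; rewrite Llog_y//.
  apply/ess_supP; apply: nearW => u.
  rewrite /patch; case: ifP => // _; rewrite lee_fin -expR0 ler_expR.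
  by rewrite oppr_le0 mulr_ge0 ?gap_ge0 ?(ltW e0).
Qed.

End Llog_calculus.

(** * From pointwise suprema over the grid to norms in [du/u] *)

Section transfer.
Context (R : realType).
Local Open Scope ereal_scope.
Local Notation mu := (@lebesgue_measure R).
Local Notation pos := [set` `]0%R, +oo[%R].

(* [F u] is dominated by the supremum over the grid points [v] of
   [G v * expR (- e * gap u (tau v))], where [G] is almost increasing on dyadic
   blocks. The bound [B] stands for that supremum, which may be infinite. *)
Definition transferable (e C : R) (tau : nat -> R) (F G : R -> R) : Prop :=
  [/\ forall u, (0 < u -> 0 <= F u)%R, forall v, (0 < v -> 0 <= G v)%R,
      forall n, (0 < tau n)%R,
      forall v v', (0 < v -> v <= v' -> v' <= 2 * v -> G v <= C * G v')%R
    & forall u B, (0 < u -> 0 <= B ->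
        (forall n, G (grid R n) * expR (- (e * gap u (tau n))) <= B) ->
        F u <= C * B)%R].

(** Here the kernel is simply bounded by 1; each grid value of [G] is controlled by the norm of [G]
    on the block that starts there. *)
Lemma Llog_transfer_y (e C : R) : (0 < e)%R -> (0 < C)%R ->
  exists2 C', (0 < C')%R & forall tau F G, transferable e C tau F G ->
    Llog +oo pos (EFin \o F) <= C'%:E * Llog +oo pos (EFin \o G).
Proof.
move=> e0 C0; have [K K0 hK] := @Llog_lower_bound R +oo (ltry _).
exists (C * (C * K))%R; first by rewrite !mulr_gt0.
move=> tau F G [F0 G0 tau0 GG FG].
have G0' u : pos u -> 0 <= (EFin \o G) u.
  by rewrite /= in_itv /= andbT lee_fin => /G0.
have := Llog_ge0 +oo pos (EFin \o G).
(* The bound in [transferable] is a real number, so an infinite norm of [G] is set aside. *)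
case E : (Llog +oo pos (EFin \o G)) => [L| |//] L0; last first.
  by rewrite gt0_muley ?leey// lte_fin !mulr_gt0.
rewrite Llog_y; last by move=> u /=; rewrite in_itv /= andbT lee_fin => /F0.
apply/ess_supP; apply: nearW => u; rewrite /patch; case: ifPn => [|_]; last first.
  by rewrite mule_ge0// lee_fin !mulr_ge0// ltW.
rewrite inE /= in_itv /= andbT -EFinM lee_fin -mulrA => u0.
apply: FG => //; first by rewrite !mulr_ge0// ltW.
move=> n; apply: (@le_trans _ _ (G (grid R n))).
  apply: ler_piMr; first by rewrite G0// grid_gt0.
  by rewrite expR_le1 oppr_le0 mulr_ge0 ?gap_ge0// ltW.
rewrite -(mulrA C) -ler_pdivrMl//.
suff : (C^-1 * G (grid R n))%:E <= K%:E * Llog +oo pos (EFin \o G).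
  by rewrite E -EFinM lee_fin.
apply: (hK (grid R n)) => //; first exact: grid_gt0.
  move=> x /=; rewrite !in_itv /= andbT => /andP[h _].
  exact: lt_trans (grid_gt0 R n) h.
move=> x /andP[h1 h2]; rewrite /= lee_fin ler_pdivrMl//.
by apply: GG; rewrite ?grid_gt0// ltW.
Qed.

(** The [p]-th power of the supremum is at most the series of the [p]-th powers. Its terms are
    constants [c n] times measurable kernels of integral at most [M], and the sum of the [c n] is
    compared with the integral of [G^p] block by block. *)
Lemma Llog_transfer_fin (p e C : R) : (0 < p)%R -> (0 < e)%R -> (0 < C)%R ->
  exists2 C', (0 < C')%R & forall tau F G, transferable e C tau F G ->
    Llog p%:E pos (EFin \o F) <= C'%:E * Llog p%:E pos (EFin \o G).
Proof.
move=> p0 e0 C0; have pe0 : (0 < p * e)%R by exact: mulr_gt0.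
have pi0 : (0 <= p^-1)%R by rewrite invr_ge0 ltW.
have [M M0 hM] := log_kernel_integral pe0.
pose D := (C `^ p)%R; have D0 : (0 < D)%R by exact: powR_gt0.
have C'0 : (0 < D * (M * (2 * D)))%R by rewrite !mulr_gt0.
exists ((D * (M * (2 * D))) `^ p^-1)%R; first exact: powR_gt0.
move=> tau F G [F0 G0 tau0 GG FG].
have posE u : pos u = (0 < u)%R by rewrite /= in_itv /= andbT.
rewrite !Llog_EFin//; last 2 first.
- by move=> u; rewrite posE lee_fin => /G0.
- by move=> u; rewrite posE lee_fin => /F0.
pose c n := (G (grid R n) `^ p)%R.
have c0 n : (0 <= c n)%R by exact: powR_ge0.
pose k n := (fun u => (expR (- ln u - p * e * gap u (tau n)))%:E) \_ pos.
have k0 n u : 0 <= k n u by rewrite /k /patch; case: ifP.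
have mk n : measurable_fun [set: R] (k n).
  apply/(measurable_restrictT _ _).1 => //.
  apply: measurable_funTS; exact: measurable_log_kernel.
pose fF := (fun u => (expR (- ln u))%:E * (EFin \o F) u `^ p) \_ pos.
pose fG := (fun u => (expR (- ln u))%:E * (EFin \o G) u `^ p) \_ pos.
have fF0 u : 0 <= fF u.
  by rewrite /fF /patch; case: ifP => // _; rewrite mule_ge0 ?poweR_ge0 ?lee_fin ?expR_ge0.
have fG0 u : 0 <= fG u.
  by rewrite /fG /patch; case: ifP => // _; rewrite mule_ge0 ?poweR_ge0 ?lee_fin ?expR_ge0.
have ck0 n u : 0 <= (c n)%:E * k n u by rewrite mule_ge0 ?lee_fin.
have leF u : fF u <= D%:E * \sum_(n <oo) (c n)%:E * k n u.
  have S0 : 0 <= \sum_(n <oo) (c n)%:E * k n u by exact: nneseries_ge0.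
  rewrite /fF /patch; case: ifPn => [|_]; last by rewrite mule_ge0 ?lee_fin ?(ltW D0).
  rewrite inE posE => u0 /=.
  have [->|Soo] := eqVneq (\sum_(n <oo) (c n)%:E * k n u) +oo.
    by rewrite gt0_muley ?leey// lte_fin.
  have Sfin : \sum_(n <oo) (c n)%:E * k n u \is a fin_num.
    by rewrite ge0_fin_numE// ltey.
  pose S := (u * fine (\sum_(n <oo) (c n)%:E * k n u))%R.
  have S00 : (0 <= S)%R by rewrite mulr_ge0 ?(ltW u0)// fine_ge0.
  have FS : (F u <= C * S `^ p^-1)%R.
    apply: FG => //; first exact: powR_ge0.
    move=> n; have x0 : (0 <= G (grid R n) * expR (- (e * gap u (tau n))))%R.
      by rewrite mulr_ge0 ?expR_ge0 ?G0 ?grid_gt0.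
    rewrite -[leLHS](powRr1 x0) -(mulfV (lt0r_neq0 p0)) powRrM.
    apply: ge0_ler_powR; rewrite ?nnegrE ?powR_ge0//.
    rewrite powRM ?expR_ge0 ?G0 ?grid_gt0// -/(c n).
    rewrite /S [leRHS]mulrC -ler_pdivrMr//.
    rewrite -lee_fin fineK//; apply: le_trans (le_nneseries_term n _) => //.
    rewrite /k /patch mem_set ?posE// -EFinM lee_fin -(mulrA (c n)); apply: ler_wpM2l => //.
    rewrite expRD (expRN (ln u)) lnK ?posrE// mulrC ler_pM2l ?invr_gt0//.
    by rewrite {1}/powR gt_eqF ?expR_gt0// expRK mulrN mulrA.
  rewrite -EFinM -[X in _ <= _ * X](fineK Sfin) -EFinM lee_fin.
  rewrite expRN lnK ?posrE// ler_pdivrMl// mulrCA -/S.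
  apply: (@le_trans _ _ ((C * S `^ p^-1) `^ p)%R).
    by apply: ge0_ler_powR; rewrite ?nnegrE ?F0 ?(ltW p0) ?mulr_ge0 ?powR_ge0 ?(ltW C0).
  rewrite powRM ?powR_ge0 ?(ltW C0)// -powRrM mulVf ?gt_eqF// powRr1//.
have leG u : \sum_(n <oo) (c n)%:E * ((grid R n)^-1 * \1_([set` `[grid R n, 2 * grid R n[%R]) u)%:E
    <= (2 * D)%:E * fG u.
  have [u0|u0] := ltP 0%R u; last first.
    rewrite eseries0 ?mule_ge0 ?lee_fin ?mulr_ge0 ?(ltW D0)// => n _ _.
    rewrite indicE memNset ?mulr0 ?mule0//= in_itv /= => /andP[h _].
    have := lt_le_trans (grid_gt0 R n) (le_trans h u0); by rewrite ltxx.
  have [n hn] := grid_cover u0.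
  have t0 : (0 <= (c n)%:E * ((grid R n)^-1 * \1_([set` `[grid R n, 2 * grid R n[%R]) u)%:E).
    by rewrite -EFinM lee_fin !mulr_ge0 ?invr_ge0 ?(ltW (grid_gt0 _ _))// indicE.
  rewrite (@nneseries_single _ _ n)//; last first.
    move=> m mn; rewrite indicE memNset ?mulr0 ?mule0//= in_itv /= => hm.
    by move: mn; rewrite (grid_unique hm hn) eqxx.
  rewrite indicE mem_set ?in_itv//= ?in_itv//= mulr1.
  rewrite /fG /patch mem_set ?posE//= -!EFinM lee_fin.
  have /andP[n1 n2] := hn; have g0 := grid_gt0 R n.
  rewrite expRN lnK ?posrE//.
  have h1 : (c n <= D * G u `^ p)%R.
    rewrite -powRM ?G0 ?(ltW C0)//; apply: ge0_ler_powR; rewrite ?nnegrE ?(ltW p0) ?G0//.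
      by rewrite mulr_ge0 ?G0// ltW.
    by apply: GG => //; exact: ltW.
  have h2 : ((grid R n)^-1 <= 2 * u^-1)%R.
    by rewrite ler_pdivlMr// mulrC ler_pdivrMr// ltW.
  rewrite [leRHS](_ : _ = (D * G u `^ p) * (2 * u^-1))%R; last by ring.
  by apply: ler_pM => //; rewrite invr_ge0 ltW.
(* Each normalized indicator has integral 1, so the sum of the [c n] is the integral of the left
   side of [leG]. *)
have sumG : \sum_(n <oo) (c n)%:E <= (2 * D)%:E * \int[mu]_u fG u.
  have h0 n u : 0 <= ((grid R n)^-1 * \1_([set` `[grid R n, 2 * grid R n[%R]) u)%:E :> \bar R.
    by rewrite lee_fin mulr_ge0 ?invr_ge0 ?(ltW (grid_gt0 _ _))// indicE.
  have mh n : measurable_fun [set: R] (fun u =>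
      ((grid R n)^-1 * \1_([set` `[grid R n, 2 * grid R n[%R]) u)%:E).
    by apply/measurable_EFinP; apply: measurable_funM.
  apply: (@le_trans _ _ (\int[mu]_u \sum_(n <oo) (c n)%:E *
      ((grid R n)^-1 * \1_([set` `[grid R n, 2 * grid R n[%R]) u)%:E)).
    have mch n : measurable_fun [set: R] (fun u => (c n)%:E *
        ((grid R n)^-1 * \1_([set` `[grid R n, 2 * grid R n[%R]) u)%:E).
      apply: emeasurable_funM => //; exact: mh.
    rewrite (integral_nneseries mu measurableT mch); last first.
      by move=> n u _; apply: mule_ge0; [rewrite lee_fin|exact: h0].
    apply: lee_nneseries => [n _ _|n _]; first by rewrite lee_fin.
    have h0' u : [set: R] u -> 0 <= ((grid R n)^-1 * \1_([set` `[grid R n, 2 * grid R n[%R]) u)%:E.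
      by move=> _; exact: h0.
    rewrite (ge0_integralZl_EFin mu measurableT h0' (mh n) (c0 n)).
    by rewrite (integral_dyadic _ _ (grid_gt0 R n)) mule1.
  apply: le_integralZl => //; first by rewrite mulr_gt0.
  by move=> u; apply: nneseries_ge0 => n _ _; apply: mule_ge0; [rewrite lee_fin|exact: h0].
rewrite -/fF -/fG -poweR_EFin -poweRM; last 2 first.
- by rewrite lee_fin ltW.
- exact: integral_ge0.
apply: le_poweR => //; first exact: integral_ge0.
have iS0 : forall u, 0 <= \sum_(n <oo) (c n)%:E * k n u.
  by move=> u; exact: nneseries_ge0.
apply: (le_trans (le_integralZl mu D0 fF0 iS0 leF)).
rewrite EFinM -muleA; apply: lee_wpmul2l; first by rewrite lee_fin ltW.
have mck n : measurable_fun [set: R] (fun u => (c n)%:E * k n u).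
  by apply: emeasurable_funM.
rewrite (integral_nneseries mu measurableT mck (fun n u _ => ck0 n u)).
rewrite EFinM -muleA.
apply: le_trans (lee_wpmul2l _ sumG); last by rewrite lee_fin ltW.
rewrite -nneseriesZl; last by move=> n _; rewrite lee_fin.
apply: lee_nneseries => [n _ _|n _].
  by apply: integral_ge0 => u _; rewrite mule_ge0 ?lee_fin.
rewrite (ge0_integralZl_EFin mu measurableT (fun u _ => k0 n u) (mk n) (c0 n)).
by rewrite muleC; apply: lee_wpmul2r; rewrite ?lee_fin// hM.
Qed.

Lemma Llog_transfer (q : \bar R) (e C : R) : 0 < q -> (0 < e)%R -> (0 < C)%R ->
  exists2 C', (0 < C')%R & forall tau F G, transferable e C tau F G ->
    Llog q pos (EFin \o F) <= C'%:E * Llog q pos (EFin \o G).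
Proof.
case: q => [p||//]; first by rewrite lte_fin; exact: Llog_transfer_fin.
by move=> _; exact: Llog_transfer_y.
Qed.

End transfer.

(** * Slowly varying weights *)

(* Slow variation in logarithmic form, without the measurability. *)
Definition slow (R : realType) (b : R -> R) : Prop :=
  (forall t, 0 < t -> 0 < b t) /\
  forall e, 0 < e -> exists c, forall s t, 0 < s -> 0 < t ->
    ln (b s) <= ln (b t) + e * gap s t + c.

Section slow.
Context (R : realType).
Implicit Types a b : R -> R.

(** For [s <= t] the almost increasing [t^e b(t)] gives the bound, for [t <= s] the almost
    decreasing [t^-e b(t)]. The equivalence is used once at each of the two points, hence the
    doubled logarithms of the constants. *)
Lemma SV_slow b : SV b -> slow b.
Proof.
case=> b0 _ bi bd; split => // e e0.
have [g [g0 gi [C C0 gC]]] := bi _ e0.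
have [h [h0 hd [D D0 hD]]] := bd _ e0.
have powE (x y t : R) : 0 < t -> 0 < y -> ln (t `^ x * y) = x * ln t + ln y.
  by move=> t0 y0; rewrite lnM ?posrE ?powR_gt0// ln_powR.
have gapE s t : s <= t -> 0 < s -> gap s t = ln t - ln s.
  by move=> st s0; rewrite gapC /gap ger0_norm// subr_ge0 ler_ln ?posrE// (lt_le_trans s0).
have pp t x : 0 < t -> 0 < t `^ x * b t.
  by move=> t0; rewrite mulr_gt0 ?powR_gt0 ?b0.
exists (Num.max (2 * ln C) (2 * ln D)) => s t s0 t0.
have [st|/ltW ts] := leP s t.
  have [h1 _] := gC _ s0; have [_ h2] := gC _ t0; have h3 := gi _ _ s0 st.
  have : s `^ e * b s <= C * (C * (t `^ e * b t)).
    apply: (le_trans h1); rewrite ler_pM2l//; exact: le_trans h2.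
  rewrite -ler_ln ?posrE ?mulr_gt0 ?powR_gt0 ?b0//.
  rewrite !lnM ?posrE ?mulr_gt0 ?powR_gt0 ?b0//.
  rewrite !ln_powR gapE//.
  have : 2 * ln C <= Num.max (2 * ln C) (2 * ln D) by rewrite le_max lexx.
  lra.
have [h1 _] := hD _ s0; have [_ h2] := hD _ t0; have h3 := hd _ _ t0 ts.
have : s `^ (- e) * b s <= D * (D * (t `^ (- e) * b t)).
  apply: (le_trans h1); rewrite ler_pM2l//; exact: le_trans h2.
rewrite -ler_ln ?posrE ?mulr_gt0 ?powR_gt0 ?b0//.
rewrite !lnM ?posrE ?mulr_gt0 ?powR_gt0 ?b0//.
rewrite !ln_powR gapC gapE//.
have : 2 * ln D <= Num.max (2 * ln C) (2 * ln D) by rewrite le_max lexx orbT.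
lra.
Qed.

Lemma slow_mul a b : slow a -> slow b -> slow (fun t => a t * b t).
Proof.
move=> [a0 ha] [b0 hb]; split=> [t t0|e e0]; first by rewrite mulr_gt0 ?a0 ?b0.
have e2 : 0 < e / 2 by rewrite divr_gt0.
have [c hc] := ha _ e2; have [d hd] := hb _ e2.
exists (c + d) => s t s0 t0; rewrite !lnM ?posrE ?a0 ?b0//.
have := hc _ _ s0 t0; have := hd _ _ s0 t0; lra.
Qed.

Lemma slow_div a b : slow a -> slow b -> slow (fun t => a t / b t).
Proof.
move=> [a0 ha] [b0 hb]; split=> [t t0|e e0]; first by rewrite divr_gt0 ?a0 ?b0.
have e2 : 0 < e / 2 by rewrite divr_gt0.
have [c hc] := ha _ e2; have [d hd] := hb _ e2.
exists (c + d) => s t s0 t0; rewrite !ln_div ?posrE ?a0 ?b0//.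
have := hc _ _ s0 t0; have := hd _ _ t0 s0; rewrite (gapC t s); lra.
Qed.

End slow.

(** * The norm of a slowly varying function over [(0,t)] *)

Section initial_norm.
Context (R : realType).
Local Open Scope ereal_scope.
Variables (r : \bar R) (w : R -> R).
Hypotheses (r0 : 0 < r) (sw : slow w).
Local Notation pos := [set` `]0%R, +oo[%R].
Local Notation N I := (Llog r I (EFin \o w)).
Hypothesis w1 : N [set` `]0%R, 1%R[] < +oo.

Definition initial_norm (t : R) : R := fine (N [set` `]0%R, t[%R]).
Local Notation W := initial_norm.

Let w0 t : (0 < t)%R -> (0 < w t)%R. Proof. exact: sw.1. Qed.

(** Slow variation with exponent [e / 2] gives [w u <= C * w t * expR (e / 2 * gap u t)]. Writing
    [e / 2] as [e - e / 2] bounds the growth by its value at [s] and leaves a decaying kernel of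
    bounded norm. *)
Lemma slow_tail_norm (e : R) : (0 < e)%R -> exists2 C, (0 < C)%R &
  forall s t, (0 < t)%R ->
  N [set` `[t, s[%R] <= (C * (w t * expR (e * gap s t)))%:E.
Proof.
move=> e0; have e2 : (0 < e / 2)%R by rewrite divr_gt0.
have [c hc] := sw.2 _ e2.
have [K K0 hK] := Llog_gap r0 e2.
exists (expR c * K)%R; first by rewrite mulr_gt0// expR_gt0.
move=> s t t0; rewrite -mulrA (mulrC K) mulrA EFinM.
have M0 : (0 < expR c * (w t * expR (e * gap s t)))%R.
  by rewrite !mulr_gt0 ?expR_gt0 ?w0.
apply: (le_trans _ (lee_wpmul2l _ (hK t t0))); last by rewrite lee_fin ltW.
apply: Llog_le => //.
- by move=> u /=; rewrite !in_itv /= andbT => /andP[h _]; exact: lt_le_trans h.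
- move=> u /=; rewrite in_itv /= lee_fin => /andP[h _]; apply/ltW/w0.
  exact: lt_le_trans h.
- move=> u /=; rewrite in_itv /= => /andP[tu us].
  have u0 : (0 < u)%R by exact: lt_le_trans tu.
  rewrite -EFinM lee_fin -{1}(@lnK _ (w u)) ?posrE ?w0//.
  rewrite -{1}(@lnK _ (w t)) ?posrE ?w0// -!expRD ler_expR.
  have := hc _ _ u0 t0.
  have g1 : (gap u t <= gap s t)%R.
    have l1 : (ln t <= ln u)%R by rewrite ler_ln ?posrE.
    have l2 : (ln u <= ln s)%R by rewrite ler_ln ?posrE// ?(lt_trans u0)// ltW.
    rewrite /gap !ger0_norm ?subr_ge0//; last exact: le_trans l2.
    lra.
  have : (e * gap u t <= e * gap s t)%R by rewrite ler_pM2l.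
  lra.
Qed.

Lemma initial_norm_le s t : (s <= t)%R ->
  N [set` `]0%R, s[] <= N [set` `]0%R, t[].
Proof.
move=> st; rewrite -[leRHS]mul1e; apply: Llog_le => //.
- move=> u /=; rewrite !in_itv /= => /andP[-> h]; exact: lt_le_trans st.
- by move=> u /=; rewrite in_itv /= lee_fin => /andP[h _]; apply/ltW/w0.
- by move=> u /=; rewrite in_itv /= lee_fin => /andP[h _]; apply/ltW/w0.
- by move=> u _; rewrite mul1e.
Qed.

Lemma initial_norm_split s t : (0 < t)%R -> (t <= s)%R ->
  N [set` `]0%R, s[] <= (2 `^ fine r^-1)%:E *
    (N [set` `]0%R, t[] + N [set` `[t, s[%R]).
Proof.
move=> t0 ts; apply: Llog_setU => //.
- by move=> u /=; rewrite !in_itv /= => /andP[-> h]; exact: lt_le_trans ts.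
- move=> u /=; rewrite !in_itv /= => /andP[u0 us].
  by have [tu|ut] := leP t u; [right|left]; rewrite ?u0 ?us.
- move=> u []/=; rewrite in_itv /= lee_fin => /andP[h _]; apply/ltW/w0 => //.
  exact: lt_le_trans h.
Qed.

Lemma initial_norm_EFin t : (0 < t)%R -> N [set` `]0%R, t[] = (W t)%:E.
Proof.
move=> t0; rewrite /W fineK// ge0_fin_numE ?Llog_ge0//.
have [t1|/ltW t1] := leP t 1%R.
  by apply: le_lt_trans w1; exact: initial_norm_le.
have := initial_norm_split ltr01 t1.
have [C C0 hC] := slow_tail_norm ltr01.
move/le_lt_trans; apply.
apply: lte_mul_pinfty; rewrite ?lee_fin ?powR_ge0//.
apply: lte_add_pinfty => //; apply: le_lt_trans (hC t 1%R ltr01) _.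
exact: ltry.
Qed.

(** On the block from [t / 2] to [t], which lies inside [(0,t)], [w] is comparable to [w t]. *)
Lemma le_initial_norm : exists2 C, (0 < C)%R &
  forall t, (0 < t)%R -> (w t <= C * W t)%R.
Proof.
have [c hc] := sw.2 _ ltr01.
have [K K0 hK] := Llog_lower_bound r0.
exists (expR (ln 2 + c) * K)%R; first by rewrite mulr_gt0// expR_gt0.
move=> t t0; rewrite -mulrA -ler_pdivrMl ?expR_gt0//.
rewrite -lee_fin [leRHS]EFinM -initial_norm_EFin//.
have t20 : (0 < t / 2)%R by rewrite divr_gt0.
apply: (hK (t / 2)%R) => //.
- by move=> u /=; rewrite !in_itv /= => /andP[h1 h2]; apply/andP; split; lra.
- by move=> u /=; rewrite in_itv /= lee_fin => /andP[h _]; apply/ltW/w0.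
- move=> u /andP[h1 h2] /=; have u0 : (0 < u)%R by exact: lt_trans h1.
  rewrite lee_fin ler_pdivrMl ?expR_gt0//.
  rewrite -{1}(@lnK _ (w t)) ?posrE ?w0// -{1}(@lnK _ (w u)) ?posrE ?w0//.
  rewrite -expRD ler_expR.
  have := hc _ _ t0 u0.
  have : (gap u t <= ln 2)%R by apply: gap_double => //; lra.
  rewrite gapC; lra.
Qed.

Lemma initial_norm_gt0 t : (0 < t)%R -> (0 < W t)%R.
Proof.
move=> t0; have [C C0 /(_ t t0)] := le_initial_norm.
by move=> /(lt_le_trans (w0 t0)); rewrite pmulr_rgt0.
Qed.

(** [W] is nondecreasing. Conversely, its growth from [t] to [s] is governed by the tail norm, hence
    by [w t], which [W t] dominates. *)
Lemma initial_norm_slow : slow W.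
Proof.
split=> [t|e e0]; first exact: initial_norm_gt0.
have [C C0 hC] := slow_tail_norm e0.
have [D D0 hD] := le_initial_norm.
pose M := (2 `^ fine r^-1 * (1 + C * D))%R.
have M0 : (0 < M)%R by rewrite mulr_gt0 ?powR_gt0// addr_gt0// mulr_gt0.
have M1 : (0 <= ln (1 + M))%R by rewrite ln_ge0// lerDl ltW.
(* Adding 1 to [M] makes the constant nonnegative, as the monotone case requires. *)
exists (ln (1 + M)) => s t s0 t0.
have Wt0 := initial_norm_gt0 t0; have Ws0 := initial_norm_gt0 s0.
have [st|/ltW ts] := leP s t.
  have : (W s <= W t)%R.
    by rewrite -lee_fin -!initial_norm_EFin//; exact: initial_norm_le.
  rewrite -ler_ln ?posrE//.
  have : (0 <= e * gap s t)%R by rewrite mulr_ge0 ?gap_ge0 ?ltW.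
  lra.
have gE1 : (1 <= expR (e * gap s t))%R.
  by rewrite -expR0 ler_expR mulr_ge0 ?gap_ge0 ?ltW.
have : (W s <= M * (expR (e * gap s t) * W t))%R.
  rewrite -lee_fin -initial_norm_EFin//.
  apply: (le_trans (initial_norm_split t0 ts)).
  rewrite /M -mulrA [leRHS]EFinM; apply: lee_wpmul2l.
    by rewrite lee_fin powR_ge0.
  rewrite mulrDl EFinD; apply: leeD.
    by rewrite mul1r initial_norm_EFin// lee_fin ler_peMl// ltW.
  apply: (le_trans (hC _ _ t0)); rewrite lee_fin -mulrA ler_pM2l//.
  rewrite mulrC mulrCA ler_pM2l ?expR_gt0//; exact: hD.
clearbody M; rewrite -ler_ln ?posrE ?mulr_gt0 ?expR_gt0//.
rewrite !lnM ?posrE ?mulr_gt0 ?expR_gt0// expRK.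
have : (ln M <= ln (1 + M))%R by rewrite ler_ln ?posrE ?addr_gt0// lerDr.
lra.
Qed.

End initial_norm.

(** * Two-sided estimates for the norm of the R-spaces *)

Section Rnorm.
Context (R : realType).
Local Open Scope ereal_scope.
Local Notation pos := [set` `]0%R, +oo[%R].

Definition Rnorm (s : R) (r : \bar R) (w : R -> R) (q : \bar R) (a : R -> R)
    (k : R -> \bar R) : \bar R :=
  Llog r pos (fun x => (w x)%:E *
    Llog q [set` `]x, +oo[%R] (fun u => (expR (- (s * ln u)) * a u)%:E * k u)).

Variables (s : R) (r q : \bar R) (w a : R -> R).
Hypotheses (r0 : 0 < r) (q0 : 0 < q) (sw : slow w) (sa : slow a).
Hypothesis w1 : Llog r [set` `]0%R, 1%R[] (EFin \o w) < +oo.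
Local Notation W := (initial_norm r w).

Let w0 t : (0 < t)%R -> (0 < w t)%R. Proof. exact: sw.1. Qed.
Let a0 t : (0 < t)%R -> (0 < a t)%R. Proof. exact: sa.1. Qed.
Let W0 t : (0 < t)%R -> (0 < W t)%R. Proof. exact: initial_norm_gt0. Qed.

Let weight_ge0 x u (k : R -> \bar R) : (0 < x)%R -> (x < u)%R ->
  (forall v, (0 < v)%R -> 0 <= k v) -> 0 <= (expR (- (s * ln u)) * a u)%:E * k u.
Proof.
move=> x0 xu k0; have u0 : (0 < u)%R by exact: lt_trans xu.
by rewrite mule_ge0 ?k0// lee_fin mulr_ge0 ?expR_ge0// ltW// a0.
Qed.

(** The weight cancels against the bound on [k] down to [S / W u * expR (- (e * gap u t))]. Of the
    exponent [e], a quarter replaces [W u] by [W t], a half makes the norm converge, and the last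
    quarter gives the decay in [x], because [u > x] forces [gap u t] above [ln x - ln t]. *)
Lemma Rnorm_inner_le (e : R) : (0 < e)%R -> exists2 C, (0 < C)%R &
  forall t S k x, (0 < t)%R -> (0 < S)%R -> (0 < x)%R ->
  (forall u, (0 < u)%R -> 0 <= k u) ->
  (forall u, (0 < u)%R ->
     k u <= (S * expR (s * ln u - ln (a u * W u) - e * gap u t))%:E) ->
  Llog q [set` `]x, +oo[%R] (fun u => (expR (- (s * ln u)) * a u)%:E * k u) <=
  (C * S / W t * expR (- (e / 4 * Num.max 0 (ln x - ln t))))%:E.
Proof.
move=> e0; have e4 : (0 < e / 4)%R by rewrite divr_gt0.
have e2 : (0 < e / 2)%R by rewrite divr_gt0.
have [c hc] := (initial_norm_slow r0 sw w1).2 _ e4.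
have [K K0 hK] := Llog_gap q0 e2.
exists (expR c * K)%R; first by rewrite mulr_gt0// expR_gt0.
move=> t S k x t0 S0 x0 k0 kS; set p := Num.max _ _.
rewrite [X in _ <= X%:E](_ : _ = (expR c * S / W t * expR (- (e / 4 * p))) * K)%R; last by ring.
rewrite EFinM.
have M0 : (0 < expR c * S / W t * expR (- (e / 4 * p)))%R.
  by rewrite !mulr_gt0 ?expR_gt0 ?invr_gt0 ?W0.
apply: (le_trans _ (lee_wpmul2l _ (hK t t0))); last by rewrite lee_fin ltW.
apply: Llog_le => //.
- by move=> u /=; rewrite !in_itv /= !andbT; exact: lt_trans.
- move=> u /=; rewrite in_itv /= andbT => xu; exact: weight_ge0 xu k0.
- move=> u /=; rewrite in_itv /= andbT => xu.
  have u0 : (0 < u)%R by exact: lt_trans xu.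
  apply: (le_trans (lee_wpmul2l _ (kS u u0))).
    by rewrite lee_fin mulr_ge0 ?expR_ge0// ltW// a0.
  rewrite -!EFinM lee_fin.
  rewrite lnM ?posrE ?a0 ?W0//.
  rewrite -{1}(@lnK _ (a u)) ?posrE ?a0// -{1}(@lnK _ S) ?posrE//.
  rewrite -{2}(@lnK _ S) ?posrE// -{1}(@lnK _ (W t)) ?posrE ?W0//.
  rewrite -expRN -!expRD ler_expR.
  have := hc _ _ t0 u0; rewrite gapC.
  have : (p <= gap u t)%R.
    rewrite /p ge_max gap_ge0 /=.
    have : (ln x <= ln u)%R by rewrite ler_ln ?posrE// ltW.
    have := ler_norm (ln u - ln t)%R; rewrite /gap; lra.
  rewrite -(@ler_pM2l _ (e / 4)%R)//; lra.
Qed.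

(** The outer norm is cut at [t]. Below [t] the inner norm is at most [C * S / W t], and the norm of
    [w] over [(0,t)] is exactly [W t]. Above [t] half of the remaining decay absorbs the variation
    of [w], and [w t / W t] is bounded. *)
Lemma Rnorm_le_pos (e : R) : (0 < e)%R -> exists2 C, (0 < C)%R &
  forall t S k, (0 < t)%R -> (0 < S)%R ->
  (forall u, (0 < u)%R -> 0 <= k u) ->
  (forall u, (0 < u)%R ->
     k u <= (S * expR (s * ln u - ln (a u * W u) - e * gap u t))%:E) ->
  Rnorm s r w q a k <= (C * S)%:E.
Proof.
move=> e0; have [C C0 hC] := Rnorm_inner_le e0.
have e8 : (0 < e / 8)%R by rewrite divr_gt0.
have [c hc] := sw.2 _ e8.
have [D D0 hD] := le_initial_norm r0 sw w1.
have [K K0 hK] := Llog_gap r0 e8.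
exists (2 `^ fine r^-1 * (C + C * expR c * D * K))%R.
  by rewrite !mulr_gt0 ?powR_gt0// addr_gt0 ?mulr_gt0 ?expR_gt0.
move=> t S k t0 S0 k0 kS.
have Wt0 := W0 t0.
have in0 x : (0 < x)%R -> 0 <= (w x)%:E *
    Llog q [set` `]x, +oo[%R] (fun u => (expR (- (s * ln u)) * a u)%:E * k u).
  by move=> x0; rewrite mule_ge0 ?Llog_ge0// lee_fin ltW// w0.
pose F x := (w x)%:E *
  Llog q [set` `]x, +oo[%R] (fun u => (expR (- (s * ln u)) * a u)%:E * k u).
rewrite /Rnorm -/F.
have split : Llog r pos F <= (2 `^ fine r^-1)%:E *
    (Llog r [set` `]0%R, t[%R] F + Llog r [set` `[t, +oo[%R] F).
  apply: Llog_setU => //.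
  - by move=> u /=; rewrite !in_itv /= andbT => /andP[].
  - move=> u /=; rewrite !in_itv /= !andbT => u0.
    by have [tu|ut] := leP t u; [right|left; rewrite u0].
  - move=> u [] /=; rewrite in_itv /= ?andbT; first by move=> /andP[h _]; exact: in0.
    move=> h; apply: in0; exact: lt_le_trans h.
apply: (le_trans split); rewrite -(mulrA (2 `^ _)%R) [leRHS]EFinM; apply: lee_wpmul2l.
  by rewrite lee_fin powR_ge0.
rewrite mulrDl EFinD; apply: leeD.
- have M0 : (0 < C * S / W t)%R by rewrite !mulr_gt0 ?invr_gt0.
  rewrite (_ : (C * S)%:E = (C * S / W t)%:E * (W t)%:E); last first.
    by rewrite -EFinM divfK// gt_eqF.
  rewrite -initial_norm_EFin//; apply: Llog_le => //.
  + by move=> u /=; rewrite in_itv /= => /andP[h _]; exact: in0.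
  + by move=> u /=; rewrite in_itv /= lee_fin => /andP[h _]; apply/ltW/w0.
  + move=> u /=; rewrite in_itv /= => /andP[u0 ut].
    rewrite /F muleC; apply: lee_wpmul2r; first by rewrite lee_fin ltW// w0.
    apply: (le_trans (hC _ _ _ _ t0 S0 u0 k0 kS)); rewrite lee_fin.
    rewrite ler_piMr ?(ltW M0)// expR_le1 oppr_le0 mulr_ge0 ?le_max ?lexx//.
    by rewrite divr_ge0 // ltW.
- rewrite (_ : (C * expR c * D * K * S)%:E = (C * S * expR c * D)%:E * K%:E); last first.
    by rewrite -EFinM; congr EFin; ring.
  have M0 : (0 < C * S * expR c * D)%R by rewrite !mulr_gt0 ?expR_gt0.
  apply: (le_trans _ (lee_wpmul2l _ (hK t t0))); last by rewrite lee_fin ltW.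
  apply: Llog_le => //.
  + by move=> u /=; rewrite !in_itv /= !andbT; exact: lt_le_trans.
  + move=> u /=; rewrite in_itv /= andbT => h; apply: in0; exact: lt_le_trans h.
  + move=> u /=; rewrite in_itv /= andbT => tu.
    have u0 : (0 < u)%R by exact: lt_le_trans tu.
    apply: (@le_trans _ _ ((w u)%:E * (C * S / W t *
        expR (- (e / 4 * Num.max 0 (ln u - ln t))))%:E)).
      by apply: lee_wpmul2l; [rewrite lee_fin ltW// w0|exact: hC].
    rewrite -!EFinM lee_fin.
    have h1 : (w u * expR (- (e / 4 * Num.max 0 (ln u - ln t))) <=
        expR c * w t * expR (- (e / 8 * gap u t)))%R.
      rewrite -{1}(@lnK _ (w u)) ?posrE ?w0// -{1}(@lnK _ (w t)) ?posrE ?w0//.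
      rewrite -!expRD ler_expR.
      have l1 : (ln t <= ln u)%R by rewrite ler_ln ?posrE.
      have := hc _ _ u0 t0.
      by rewrite /gap ger0_norm ?subr_ge0// max_r ?subr_ge0//; lra.
    have h2 : (w t / W t <= D)%R by rewrite ler_pdivrMr//; exact: hD.
    apply: (@le_trans _ _ (C * S / W t * (expR c * w t * expR (- (e / 8 * gap u t))))%R).
      by rewrite mulrCA ler_pM2l// !mulr_gt0 ?invr_gt0.
    rewrite [leLHS](_ : _ = C * S * expR c * (w t / W t) * expR (- (e / 8 * gap u t)))%R; last by ring.
    by rewrite ler_pM2r ?expR_gt0// ler_pM2l// !mulr_gt0 ?expR_gt0.
Qed.

(** Extends the estimate to [S = 0], where logarithms of [S] make no sense, by letting a positive
    [S] decrease to its limit. *)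
Lemma Rnorm_le (e : R) : (0 < e)%R -> exists2 C, (0 < C)%R &
  forall t S k, (0 < t)%R -> (0 <= S)%R ->
  (forall u, (0 < u)%R -> 0 <= k u) ->
  (forall u, (0 < u)%R ->
     k u <= (S * expR (s * ln u - ln (a u * W u) - e * gap u t))%:E) ->
  Rnorm s r w q a k <= (C * S)%:E.
Proof.
move=> e0; have [C C0 hC] := Rnorm_le_pos e0; exists C => // t S k t0 S0 k0 kS.
apply/lee_addgt0Pr => d d0.
have dC : (0 < d / C)%R by rewrite divr_gt0.
rewrite -EFinD (_ : C * S + d = C * (S + d / C))%R; last first.
  by field; rewrite gt_eqF.
apply: (hC t) => //; first by rewrite ltr_wpDl.
move=> u u0; apply: (le_trans (kS u u0)); rewrite lee_fin.
by rewrite ler_pM2r ?expR_gt0// lerDl ltW.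
Qed.

Lemma Rnorm_ge : exists2 C, (0 < C)%R &
  forall t (kt : R) k, (0 < t)%R -> (0 <= kt)%R ->
  (forall u, (0 < u)%R -> 0 <= k u) ->
  (forall u, (t <= u)%R -> kt%:E <= k u) ->
  (expR (- (s * ln t)) * (a t * W t) * kt)%:E <= C%:E * Rnorm s r w q a k.
Proof.
have [c hc] := sa.2 _ ltr01.
have [K K0 hK] := Llog_lower_bound q0.
(* The loss of the weight [u^-s a(u)] over one dyadic block: the first term is for the power, the
   other two for [a] with exponent 1. *)
pose m := expR (- (`|s| * ln 2) - ln 2 - c).
have m0 : (0 < m)%R by exact: expR_gt0.
exists (K / m)%R; first by rewrite divr_gt0.
move=> t kt k t0; rewrite le_eqVlt => /orP[/eqP <-|kt0] k0 ktk.
  rewrite mulr0 mule_ge0 ?Llog_ge0// lee_fin divr_ge0// ltW//.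
pose g := (m * (expR (- (s * ln t)) * a t * kt))%R.
have g0 : (0 < g)%R by rewrite !mulr_gt0 ?expR_gt0 ?a0.
have inner x : (0 < x)%R -> (x < t)%R -> g%:E <= K%:E *
    Llog q [set` `]x, +oo[%R] (fun u => (expR (- (s * ln u)) * a u)%:E * k u).
  move=> x0 xt; apply: (hK t) => //.
  - by move=> u /=; rewrite !in_itv /= andbT => /andP[h _]; exact: lt_trans h.
  - by move=> u /=; rewrite in_itv /= andbT => h; exact: weight_ge0 h k0.
  - move=> u /andP[tu u2t]; have u0 : (0 < u)%R by exact: lt_trans tu.
    apply: (@le_trans _ _ ((expR (- (s * ln u)) * a u)%:E * kt%:E)); last first.
      apply: lee_wpmul2l; first by rewrite lee_fin mulr_ge0 ?expR_ge0 ?ltW ?a0.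
      by apply: ktk; exact: ltW.
    rewrite -EFinM lee_fin /g mulrA ler_pM2r// /m.
    rewrite -{1}(@lnK _ (a t)) ?posrE ?a0// -{1}(@lnK _ (a u)) ?posrE ?a0//.
    rewrite -!expRD ler_expR.
    have gl2 : (gap t u <= ln 2)%R by apply: gap_double => //; exact: ltW.
    have := hc _ _ t0 u0.
    have : (s * ln u - s * ln t <= `|s| * ln 2)%R.
      rewrite -mulrBr; apply: (le_trans (ler_norm _)); rewrite normrM.
      apply: ler_wpM2l => //; by rewrite gapC in gl2.
    lra.
rewrite (_ : (_ * _ * kt)%:E = (g / m)%:E * (W t)%:E); last first.
  by rewrite -EFinM /g; congr EFin; field; rewrite gt_eqF.
rewrite -initial_norm_EFin//.
have H : Llog r [set` `]0%R, t[%R] (EFin \o w) <= (K / g)%:E * Rnorm s r w q a k.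
  apply: Llog_le => //.
  - by rewrite divr_gt0.
  - by move=> u /=; rewrite !in_itv /= andbT => /andP[].
  - by move=> u /=; rewrite in_itv /= lee_fin => /andP[h _]; apply/ltW/w0.
  - move=> u /=; rewrite in_itv /= andbT => u0.
    by rewrite mule_ge0 ?Llog_ge0// lee_fin ltW// w0.
  - move=> u /=; rewrite in_itv /= => /andP[u0 ut].
    rewrite muleCA -[leLHS]mule1; apply: lee_wpmul2l.
      by rewrite lee_fin ltW// w0.
    rewrite mulrC EFinM -muleA lee_pdivlMl// mule1; exact: inner.
apply: (le_trans (lee_wpmul2l _ H)); first by rewrite lee_fin ltW// divr_gt0.
rewrite muleA -EFinM (_ : g / m * (K / g) = K / m)%R//.
by field; rewrite !gt_eqF.
Qed.

End Rnorm.

(** * The K-functional *)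

Section K_functional.
Context (R : realType) (E : lmodType R) (X0 X1 : qspace E).
(** Nonnegativity suffices for what follows, so the section applies to the given couple as well as
    to the couple of R-spaces. *)
Hypotheses (n0 : forall x, carrier X0 x -> 0 <= qnorm X0 x)
           (n1 : forall x, carrier X1 x -> 0 <= qnorm X1 x).
Implicit Types (s t : R) (f : E).
Local Notation K := (Kfun X0 X1).

Lemma Kfun_ge0 t f : 0 <= t -> (0 <= K t f)%E.
Proof.
move=> t0; apply: le_ereal_inf_tmp => _ [f0 [f1 [h0 h1 _ ->]]].
by rewrite lee_fin addr_ge0 ?mulr_ge0 ?n0 ?n1.
Qed.

Lemma Kfun_le t f0 f1 : carrier X0 f0 -> carrier X1 f1 ->
  (K t (f0 + f1) <= (qnorm X0 f0 + t * qnorm X1 f1)%:E)%E.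
Proof. by move=> h0 h1; apply: ereal_inf_lbound; exists f0, f1. Qed.

Lemma Kfun_fin t f : 0 <= t -> sum_carrier X0 X1 f -> K t f = (fine (K t f))%:E.
Proof.
move=> t0 [f0 [f1 [h0 h1 ->]]]; rewrite fineK// ge0_fin_numE ?Kfun_ge0//.
by apply: le_lt_trans (Kfun_le _ h0 h1) _; exact: ltry.
Qed.

Lemma Kfun_homo s t f : 0 <= s -> s <= t -> (K s f <= K t f)%E.
Proof.
move=> s0 st; apply: le_ereal_inf_tmp => _ [f0 [f1 [h0 h1 -> ->]]].
apply: (le_trans (Kfun_le _ h0 h1)); rewrite lee_fin lerD2l.
by apply: ler_wpM2r; rewrite ?n1.
Qed.

Lemma Kfun_ratio s t f : 0 < s -> s <= t -> (K t f <= (t / s)%:E * K s f)%E.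
Proof.
move=> s0 st; have t0 : 0 < t by exact: lt_le_trans st.
rewrite -lee_pdivrMl ?divr_gt0//; apply: le_ereal_inf_tmp => _ [f0 [f1 [h0 h1 -> ->]]].
rewrite lee_pdivrMl ?divr_gt0//; apply: (le_trans (Kfun_le _ h0 h1)).
rewrite -EFinM lee_fin mulrDr mulrA divfK ?gt_eqF// lerD2r.
by rewrite ler_peMl ?n0// ler_pdivlMr// mul1r.
Qed.

(** Joins the monotonicity of [K(t)] and of [K(t)/t]: the logarithm of [K] is 1-Lipschitz in
    [ln t]. *)
Lemma Kfun_gap s t f : 0 < s -> 0 < t -> (K s f <= (expR (gap s t))%:E * K t f)%E.
Proof.
move=> s0 t0; have [st|/ltW ts] := leP s t.
  apply: (le_trans (Kfun_homo _ (ltW s0) st)).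
  rewrite -[leLHS]mul1e; apply: lee_wpmul2r; first by rewrite Kfun_ge0// ltW.
  by rewrite lee_fin -expR0 ler_expR gap_ge0.
rewrite /gap ger0_norm ?subr_ge0 ?ler_ln ?posrE//.
by rewrite expRD expRN !lnK ?posrE//; exact: Kfun_ratio.
Qed.

Lemma fine_Kfun_ge0 t f : 0 <= t -> 0 <= fine (K t f).
Proof. by move=> t0; rewrite fine_ge0// Kfun_ge0. Qed.

Lemma fine_Kfun_gap s t f : 0 < s -> 0 < t -> sum_carrier X0 X1 f ->
  fine (K s f) <= expR (gap s t) * fine (K t f).
Proof.
by move=> s0 t0 hf; rewrite -lee_fin EFinM -!Kfun_fin ?(ltW s0) ?(ltW t0)//; exact: Kfun_gap.
Qed.

End K_functional.

(** * Near-optimal decompositions in a compatible couple *)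

Section couple.
Context (R : realType) (E : topologicalLmodType R) (A0 A1 : qspace E).
Hypothesis cc : compatible_couple A0 A1.
Implicit Types (s t : R) (f g : E).
Local Notation k t f := (fine (Kfun A0 A1 t f)).
Local Notation sumA := (sum_carrier A0 A1).

Let B0 := cc_banach0 cc.
Let B1 := cc_banach1 cc.
Let n0 := qb_ge0 B0.
Let n1 := qb_ge0 B1.

Lemma qnorm0 (X : qspace E) : quasi_banach X -> qnorm X 0 = 0.
Proof.
move=> B; have := qb_homogeneous B 0 (qb_zero B).
by rewrite scale0r normr0 mul0r.
Qed.

Lemma qnormN (X : qspace E) : quasi_banach X -> forall x, carrier X x ->
  carrier X (- x) /\ qnorm X (- x) = qnorm X x.
Proof.
move=> B x hx; rewrite -scaleN1r; split; first exact: qb_scale.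
by rewrite (qb_homogeneous B)// normrN1 mul1r.
Qed.

Lemma sum_carrier0 f : carrier A0 f -> sumA f.
Proof. by move=> hf; exists f, 0; rewrite addr0; split=> //; exact: qb_zero. Qed.

Lemma sum_carrier1 f : carrier A1 f -> sumA f.
Proof. by move=> hf; exists 0, f; rewrite add0r; split=> //; exact: qb_zero. Qed.

Lemma sum_carrierD f g : sumA f -> sumA g -> sumA (f + g).
Proof.
move=> [f0 [f1 [hf0 hf1 ->]]] [g0 [g1 [hg0 hg1 ->]]].
by exists (f0 + g0), (f1 + g1); rewrite addrACA; split=> //; exact: qb_add.
Qed.

(* Needed because a decomposition that is optimal up to a factor 2 must be exact
   when [K] vanishes. *)
Lemma Kfun_eq0 t f : 0 < t -> Kfun A0 A1 t f = 0%E -> f = 0.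
Proof.
move=> t0 Kf0; apply/esym; apply: (cc_hausdorff cc) => U V U0 Vf.
exists f; split; last exact: nbhs_singleton.
have := @add_continuous E (0, 0); rewrite /continuous_at /= addr0 => /(_ _ U0).
move=> [[W0 W1] /= [hW0 hW1] hW].
have [d0 d00 hd0] := cc_included0 cc (qb_zero B0) hW0.
have [d1 d10 hd1] := cc_included1 cc (qb_zero B1) hW1.
(* A decomposition whose sum is below [d] has both parts small enough for the two inclusions, so [f]
   lies in every neighbourhood of 0. *)
pose d := Num.min d0 (t * d1).
have d_gt0 : 0 < d by rewrite lt_min d00 mulr_gt0.
have : (Kfun A0 A1 t f < d%:E)%E by rewrite Kf0 lte_fin.
move=> /ereal_inf_lt[_ [f0 [f1 [h0 h1 -> ->]]]].
rewrite lte_fin lt_min => /andP[l0 l1].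
have q0 : 0 <= qnorm A0 f0 by exact: n0.
have q1 : 0 <= t * qnorm A1 f1 by rewrite mulr_ge0 ?(ltW t0)// n1.
apply: (hW (f0, f1)); split => /=.
  by apply: hd0 => //; rewrite subr0; lra.
by apply: hd1 => //; rewrite subr0 -(ltr_pM2l t0); lra.
Qed.

Lemma Kfun_near t f : 0 < t -> sumA f -> exists f0 f1,
  [/\ carrier A0 f0, carrier A1 f1, f = f0 + f1
    & qnorm A0 f0 + t * qnorm A1 f1 <= 2 * k t f].
Proof.
move=> t0 hf; have k0 : 0 <= k t f by apply: fine_Kfun_ge0 => //; exact: ltW.
move: k0; rewrite le_eqVlt => /orP[/eqP k0|k0].
  have -> : f = 0 by apply: (Kfun_eq0 t0); rewrite (Kfun_fin n0 n1 (ltW t0) hf) -k0.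
  exists 0, 0; rewrite addr0 !qnorm0// mulr0 addr0.
  split=> //; try exact: qb_zero.
  by rewrite mulr_ge0// fine_Kfun_ge0// ltW.
have : (Kfun A0 A1 t f < (2 * k t f)%:E)%E.
  by rewrite (Kfun_fin n0 n1 (ltW t0) hf) lte_fin; lra.
move=> /ereal_inf_lt[_ [f0 [f1 [h0 h1 fE ->]]]].
by rewrite lte_fin => /ltW h; exists f0, f1.
Qed.

Lemma fine_Kfun_le t f0 f1 : 0 < t -> carrier A0 f0 -> carrier A1 f1 ->
  k t (f0 + f1) <= qnorm A0 f0 + t * qnorm A1 f1.
Proof.
move=> t0 h0 h1; rewrite -lee_fin -(Kfun_fin n0 n1 (ltW t0)); last by exists f0, f1.
exact: Kfun_le.
Qed.

Lemma Kfun_add : exists2 C : R, 0 < C & forall t f g, 0 < t -> sumA f -> sumA g ->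
  k t (f + g) <= C * (k t f + k t g).
Proof.
have [C0 hC0] := qb_triangle B0; have [C1 hC1] := qb_triangle B1.
(* The constants of [qb_triangle] carry no sign; this is one positive bound for both. *)
pose C := 1 + `|C0| + `|C1|.
have C_gt0 : 0 < C by rewrite /C; have := normr_ge0 C0; have := normr_ge0 C1; lra.
exists (2 * C); first by rewrite mulr_gt0.
move=> t f g t0 /(Kfun_near t0)[f0 [f1 [hf0 hf1 fE lf]]].
move=> /(Kfun_near t0)[g0 [g1 [hg0 hg1 gE lg]]].
have -> : f + g = (f0 + g0) + (f1 + g1) by rewrite fE gE addrACA.
apply: (le_trans (fine_Kfun_le t0 (qb_add B0 hf0 hg0) (qb_add B1 hf1 hg1))).
have a0 := n0 hf0; have a1 := n1 hf1; have b0 := n0 hg0; have b1 := n1 hg1.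
have l0 : qnorm A0 (f0 + g0) <= C * (qnorm A0 f0 + qnorm A0 g0).
  apply: (le_trans (hC0 _ _ hf0 hg0)); apply: ler_wpM2r; first exact: addr_ge0.
  by rewrite /C; have := ler_norm C0; have := normr_ge0 C1; lra.
have l1 : qnorm A1 (f1 + g1) <= C * (qnorm A1 f1 + qnorm A1 g1).
  apply: (le_trans (hC1 _ _ hf1 hg1)); apply: ler_wpM2r; first exact: addr_ge0.
  by rewrite /C; have := ler_norm C1; have := normr_ge0 C0; lra.
have l1' : t * qnorm A1 (f1 + g1) <= t * (C * (qnorm A1 f1 + qnorm A1 g1)).
  by rewrite ler_pM2l.
have : C * (qnorm A0 f0 + t * qnorm A1 f1 + (qnorm A0 g0 + t * qnorm A1 g1)) <=
    C * (2 * k t f + 2 * k t g) by rewrite ler_pM2l//; exact: lerD.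
lra.
Qed.

(** The bounds through [k t f] are read off the trivial decompositions of [f0] and [f1]. The
    remaining ones come from [f0 = f - f1] for [s <= t] and [f1 = f - f0] for [t <= s], where the
    subtracted part is already bounded by [2 * k s f]. *)
Lemma Kfun_decomposition : exists2 C : R, 0 < C & forall t f, 0 < t -> sumA f ->
  exists f0 f1, [/\ carrier A0 f0, carrier A1 f1, f = f0 + f1 &
    forall s, 0 < s ->
      [/\ k s f0 <= C * k s f, k s f0 <= C * k t f,
          k s f1 <= C * k s f & k s f1 <= C * (s / t * k t f)]].
Proof.
have [C C0 hC] := Kfun_add.
exists (2 + 3 * C); first by lra.
move=> t f t0 hf; have [f0 [f1 [h0 h1 fE lf]]] := Kfun_near t0 hf.
exists f0, f1; split=> // s s0.
have q0 := n0 h0; have q1 := n1 h1.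
have [hN0 N0] := qnormN B0 h0; have [hN1 N1] := qnormN B1 h1.
have tq1 : 0 <= t * qnorm A1 f1 by rewrite mulr_ge0// ltW.
have ks0 : 0 <= k s f by rewrite fine_Kfun_ge0// ltW.
have kt0 : 0 <= k t f by rewrite fine_Kfun_ge0// ltW.
have i0 : k s f0 <= qnorm A0 f0.
  by have := fine_Kfun_le s0 h0 (qb_zero B1); rewrite addr0 qnorm0// mulr0 addr0.
have i0' : k s (- f0) <= qnorm A0 f0.
  by have := fine_Kfun_le s0 hN0 (qb_zero B1); rewrite addr0 qnorm0// mulr0 addr0 N0.
have i1 : k s f1 <= s * qnorm A1 f1.
  by have := fine_Kfun_le s0 (qb_zero B0) h1; rewrite add0r qnorm0// add0r.
have i1' : k s (- f1) <= s * qnorm A1 f1.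
  by have := fine_Kfun_le s0 (qb_zero B0) hN1; rewrite add0r qnorm0// add0r N1.
have sq1 : s * qnorm A1 f1 <= s / t * (2 * k t f).
  rewrite -[leLHS](_ : s / t * (t * qnorm A1 f1) = _); last by field; rewrite gt_eqF.
  by rewrite ler_pM2l ?divr_gt0//; lra.
have stk : 0 <= s / t * k t f by rewrite mulr_ge0// divr_ge0// ltW.
have a1 : k s f0 <= 2 * k t f by lra.
have a2 : k s f1 <= 2 * (s / t * k t f) by lra.
have Cs : 0 <= C * k s f by rewrite mulr_ge0// ltW.
have Ct : 0 <= C * k t f by rewrite mulr_ge0// ltW.
have Cst : 0 <= C * (s / t * k t f) by rewrite mulr_ge0// ltW.
have [st|/ltW ts] := leP s t.
  have kst : s / t * k t f <= k s f.
    rewrite -lee_fin EFinM -!Kfun_fin ?(ltW s0) ?(ltW t0)//.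
    have : (Kfun A0 A1 t f <= (t / s)%:E * Kfun A0 A1 s f)%E by exact: Kfun_ratio.
    by rewrite -lee_pdivrMl ?divr_gt0// invf_div.
  split; try lra.
  have e0 : f0 = f + (- f1) by rewrite fE addrK.
  have : k s f0 <= C * (k s f + k s (- f1)).
    rewrite {1}e0; apply: hC => //; exact: sum_carrier1.
  have : C * (k s f + k s (- f1)) <= C * (k s f + 2 * k s f).
    by rewrite ler_pM2l//; lra.
  lra.
have kts : k t f <= k s f.
  rewrite -lee_fin -!Kfun_fin ?(ltW s0) ?(ltW t0)//.
  by apply: Kfun_homo => //; exact: ltW.
split; try lra.
have e1 : f1 = f + (- f0) by rewrite fE addrC addKr.
have : k s f1 <= C * (k s f + k s (- f0)).
  rewrite {1}e1; apply: hC => //; exact: sum_carrier0.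
have : C * (k s f + k s (- f0)) <= C * (k s f + 2 * k s f).
  by rewrite ler_pM2l//; lra.
lra.
Qed.

End couple.

(** * Reiteration *)

Section weights.
Context (R : realType).
Variables (theta0 theta1 theta : R) (a c0 c1 : R -> R).
Hypotheses (th0 : 0 < theta0) (th01 : theta0 < theta1) (th1 : theta1 < 1).
Hypotheses (th_gt0 : 0 < theta) (th_lt1 : theta < 1).
Hypotheses (sa : slow a) (sc0 : slow c0) (sc1 : slow c1).
Local Notation delta := (theta1 - theta0).
Local Notation eta := ((1 - theta) * theta0 + theta * theta1).

Definition rho (t : R) : R := t `^ delta * (c0 t / c1 t).

Definition asharp (t : R) : R := c0 t `^ (1 - theta) * c1 t `^ theta * a (rho t).

(* [t^-eta a#(t)] *)
Definition weight (t : R) : R := expR (- (eta * ln t)) * asharp t.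

Let d0 : 0 < delta. Proof. by rewrite subr_gt0. Qed.

Lemma rho_gt0 t : 0 < t -> 0 < rho t.
Proof. by move=> t0; rewrite /rho mulr_gt0 ?powR_gt0 ?divr_gt0 ?sc0.1 ?sc1.1. Qed.

Lemma ln_rho t : 0 < t -> ln (rho t) = delta * ln t + ln (c0 t) - ln (c1 t).
Proof.
move=> t0; have := sc0.1 _ t0; have := sc1.1 _ t0 => p1 p0.
by rewrite /rho lnM ?posrE ?powR_gt0 ?divr_gt0// ln_powR ln_div ?posrE// addrA.
Qed.

Lemma weight_gt0 t : 0 < t -> 0 < weight t.
Proof.
move=> t0; rewrite /weight /asharp !mulr_gt0 ?expR_gt0 ?powR_gt0 ?sc0.1 ?sc1.1//.
by rewrite sa.1// rho_gt0.
Qed.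

(** By the choice of [eta], [asharp] and [rho], the weight is both [t^-theta0 c0 rho^-theta a(rho)]
    and [t^-theta1 c1 rho^(1-theta) a(rho)]; each form matches one of the two R-spaces. *)
Lemma ln_weight0 t : 0 < t -> ln (weight t) =
  - (theta0 * ln t) + ln (c0 t) - theta * ln (rho t) + ln (a (rho t)).
Proof.
move=> t0; have p0 := sc0.1 _ t0; have p1 := sc1.1 _ t0.
have pr := sa.1 _ (rho_gt0 t0).
have q0 := powR_gt0 (1 - theta) p0; have q1 := powR_gt0 theta p1.
rewrite /weight lnM ?posrE ?expR_gt0//; last by rewrite !mulr_gt0.
rewrite expRK /asharp; move: (ln_rho t0) pr; move: (rho t) => rt lr pr.
by rewrite !lnM ?posrE ?mulr_gt0// !ln_powR lr; ring.
Qed.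

Lemma ln_weight1 t : 0 < t -> ln (weight t) =
  - (theta1 * ln t) + ln (c1 t) + (1 - theta) * ln (rho t) + ln (a (rho t)).
Proof. by move=> t0; rewrite ln_weight0// ln_rho//; ring. Qed.

(** Each of [c0] and [c1] may vary with exponent [delta / 4], which leaves [ln rho] with slope
    between [delta / 2] and [3 / 2 * delta] up to a constant. *)
Lemma rho_log : exists2 c, 0 <= c & forall s t, 0 < s -> 0 < t ->
  `|ln (rho s) - ln (rho t) - delta * (ln s - ln t)| <= delta / 2 * gap s t + c.
Proof.
have d4 : 0 < delta / 4 by rewrite divr_gt0.
have [x hx] := sc0.2 _ d4; have [y hy] := sc1.2 _ d4.
exists (x + y).
  by have := hx _ _ ltr01 ltr01; have := hy _ _ ltr01 ltr01; rewrite gapxx; lra.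
move=> s t s0 t0; rewrite !ln_rho// ler_norml.
have := hx _ _ s0 t0; have := hy _ _ s0 t0.
have := hx _ _ t0 s0; have := hy _ _ t0 s0; rewrite (gapC t s).
by move=> *; apply/andP; split; lra.
Qed.

Lemma rho_gap : exists2 c, 0 <= c & forall s t, 0 < s -> 0 < t ->
  gap (rho s) (rho t) <= 3 / 2 * delta * gap s t + c.
Proof.
have [c c_ge0 hc] := rho_log; exists c => // s t s0 t0.
have := hc _ _ s0 t0.
have -> : gap (rho s) (rho t) = `|(ln (rho s) - ln (rho t) - delta * (ln s - ln t))
    + delta * (ln s - ln t)| by rewrite /gap subrK.
have := ler_normD (ln (rho s) - ln (rho t) - delta * (ln s - ln t)) (delta * (ln s - ln t)).
rewrite (normrM delta) (gtr0_norm d0) -/(gap s t); lra.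
Qed.

Lemma rho_gap_ge : exists2 c, 0 <= c & forall s t, 0 < s -> 0 < t ->
  delta / 2 * gap s t <= gap (rho s) (rho t) + c.
Proof.
have [c c_ge0 hc] := rho_log; exists c => // s t s0 t0.
have := hc _ _ s0 t0.
have : delta * gap s t <= `|ln (rho s) - ln (rho t) - delta * (ln s - ln t)| + gap (rho s) (rho t).
  rewrite -{1}(gtr0_norm d0) -normrM /gap distrC.
  have := ler_normD (delta * (ln s - ln t) - (ln (rho s) - ln (rho t))) (ln (rho s) - ln (rho t)).
  by rewrite subrK.
lra.
Qed.

(** A coarse intermediate value theorem: [x] is taken within 1 of the supremum of the points where
    [ln rho] stays below [ln u]. Then [ln u] lies between the values at [x] and [x + 1], which
    differ by a bounded amount. *)
Lemma rho_surj : exists2 c, 0 <= c & forall u, 0 < u ->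
  exists2 t, 0 < t & gap u (rho t) <= c.
Proof.
have [c c_ge0 hc] := rho_log; have [c' c'_ge0 hc'] := rho_gap.
exists (3 / 2 * delta + c').
  by have := d0; lra.
move=> u u0; pose P := [set x : R | ln (rho (expR x)) <= ln u].
pose l1 := ln (rho (expR 0)).
have hs : has_sup P.
  split.
    (* To the left of 0 the function is at most [l1 + c + delta / 2 * x]; this [x] brings that bound
       below [ln u]. *)
    pose x := - ((`|l1 - ln u| + c) / (delta / 2)).
    have dx : delta / 2 * x = - (`|l1 - ln u| + c).
      by rewrite /x mulrN mulrC divfK// gt_eqF// divr_gt0.
    have x0 : x <= 0 by rewrite /x oppr_le0 divr_ge0 ?addr_ge0// divr_ge0// ltW.
    exists x; rewrite /P /=.
    have := hc _ _ (expR_gt0 x) (expR_gt0 0).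
    rewrite /gap !expRK subr0 ler_norml => /andP[_].
    rewrite (ler0_norm x0) -/l1.
    have := ler_norm (l1 - ln u).
    have -> : delta / 2 * - x = - (delta / 2 * x) by rewrite mulrN.
    have -> : delta * x = 2 * (delta / 2 * x) by field.
    by rewrite dx; lra.
  exists ((`|ln u - l1| + c) / (delta / 2)) => x; rewrite /P /= => hx.
  rewrite ler_pdivlMr ?divr_gt0//.
  have := hc _ _ (expR_gt0 x) (expR_gt0 0).
  rewrite /gap !expRK subr0 ler_norml => /andP[+ _]; rewrite -/l1.
  have := ler_norm (ln u - l1); have := normr_ge0 (ln u - l1).
  have [x0|x0] := leP 0 x; first by rewrite (ger0_norm x0); lra.
  move=> h1 h2 _; have : x * (delta / 2) <= 0.
    by rewrite mulr_le0_ge0 ?divr_ge0 ?(ltW d0) ?(ltW x0).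
  lra.
have [x Px hx] := sup_adherent ltr01 hs.
exists (expR x); first exact: expR_gt0.
have hx1 : ln u < ln (rho (expR (x + 1))).
  rewrite ltNge; apply/negP => hP.
  have : x + 1 <= sup P by apply: sup_ubound => //; exact: hs.2.
  lra.
have := hc' _ _ (expR_gt0 (x + 1)) (expR_gt0 x).
rewrite /gap !expRK addrAC subrr add0r normr1 mulr1.
move: Px; rewrite /P /= => Px.
have := ler_norm (ln (rho (expR (x + 1))) - ln (rho (expR x))).
rewrite (@ger0_norm _ (ln u - ln (rho (expR x)))) ?subr_ge0//; lra.
Qed.

Lemma weight_reg : exists2 c, 0 <= c & forall s t, 0 < s -> 0 < t ->
  gap s t <= ln 2 -> ln (weight s) <= ln (weight t) + c.
Proof.
have [x hx] := sc0.2 _ ltr01; have [y hy] := sa.2 _ ltr01.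
have [z z0 hz] := rho_gap.
have x0 : 0 <= x by have := hx _ _ ltr01 ltr01; rewrite gapxx; lra.
have y0 : 0 <= y by have := hy _ _ ltr01 ltr01; rewrite gapxx; lra.
have l2 : 0 <= ln 2 :> R by rewrite ln_ge0// ler1n.
pose G := 3 / 2 * delta * ln 2 + z.
have G0 : 0 <= G by rewrite addr_ge0// !mulr_ge0// ltW.
exists (theta0 * ln 2 + ln 2 + x + theta * G + G + y).
  rewrite !addr_ge0 ?mulr_ge0//; exact: ltW.
move=> s t s0 t0 st.
have g1 : gap (rho s) (rho t) <= G.
  apply: (le_trans (hz _ _ s0 t0)); rewrite lerD2r ler_pM2l//.
  by rewrite mulr_gt0.
rewrite !ln_weight0//.
have := hx _ _ s0 t0; have := hy _ _ (rho_gt0 s0) (rho_gt0 t0).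
have : theta0 * (ln t - ln s) <= theta0 * ln 2.
  rewrite ler_pM2l//; apply: le_trans st; rewrite gapC; exact: ler_norm.
have : theta * (ln (rho t) - ln (rho s)) <= theta * G.
  rewrite ler_pM2l//; apply: le_trans g1; rewrite gapC; exact: ler_norm.
lra.
Qed.

(** With [t] such that [rho t] is close to [u], put [X = ln u - ln (rho v)]. Besides the displayed
    terms there remains [2 * e * |X| - theta * X] for [v <= t]: one [e] from the kernel, one from
    replacing [a (rho v)] by [a u]. Up to a constant [X] is at least [delta / 2 * gap v t], so half
    of [theta] is left as decay. For [v >= t] the sign of [X] changes and [1 - theta] takes the
    place of [theta]. *)
Lemma weight_decay (e : R) : 0 < e -> e <= theta / 4 -> e <= (1 - theta) / 4 ->
  exists2 M, 0 <= M & forall u, 0 < u -> exists2 t, 0 < t &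
  (forall v, 0 < v -> v <= t -> e * gap u (rho v) - ln (weight v) <=
     M + theta * ln u - ln (a u) + theta0 * ln v - ln (c0 v) -
     theta * delta / 4 * gap v t) /\
  (forall v, t <= v -> e * gap u (rho v) - ln (weight v) <=
     M + (theta - 1) * ln u - ln (a u) + theta1 * ln v - ln (c1 v) -
     (1 - theta) * delta / 4 * gap v t).
Proof.
move=> e0 e1 e2; have [y hy] := sa.2 _ e0.
have y0 : 0 <= y by have := hy _ _ ltr01 ltr01; rewrite gapxx; lra.
have [cr cr0 hr] := rho_log; have [cs cs0 hs] := rho_surj.
exists (y + 2 * (cr + cs)); first by lra.
move=> u u0; have [t t0 ht] := hs _ u0; exists t => //.
have key (v X k : R) : 0 < k -> e <= k / 4 -> delta / 2 * gap v t - (cr + cs) <= X ->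
    k < 1 -> 2 * e * `|X| - k * X <= 2 * (cr + cs) - k * delta / 4 * gap v t.
  move=> k0 ek hX k1; set c' := cr + cs in hX *.
  have c'0 : 0 <= c' by rewrite addr_ge0.
  have g0 : 0 <= delta / 2 * gap v t by rewrite mulr_ge0 ?gap_ge0// divr_ge0 ?ltW.
  have nX : `|X| <= X + 2 * c'.
    by have [X0|X0] := leP 0 X; [rewrite ger0_norm|rewrite ltr0_norm]; lra.
  have h1 : 2 * e * `|X| <= k / 2 * (X + 2 * c').
    apply: ler_pM => //; lra.
  have h2 : k / 2 * (delta / 2 * gap v t - c') <= k / 2 * X.
    by rewrite ler_pM2l// divr_gt0.
  have h3 : k * c' <= 1 * c' by rewrite ler_wpM2r// ltW.
  lra.
have gapX v : gap u (rho v) = `|ln u - ln (rho v)| by [].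
move: ht; rewrite gapX ler_norml => /andP[t1 t2].
split=> v.
- move=> v0 vt; rewrite ln_weight0//.
  have gE : gap v t = ln t - ln v.
    by rewrite gapC /gap ger0_norm// subr_ge0 ler_ln ?posrE.
  have := hr _ _ v0 t0; rewrite ler_norml => /andP[_ h].
  have hX : delta / 2 * gap v t - (cr + cs) <= ln u - ln (rho v).
    by rewrite gE in h *; lra.
  have := key v _ _ th_gt0 e1 hX th_lt1.
  have := hy _ _ u0 (rho_gt0 v0); rewrite gapX; lra.
- move=> tv; have v0 : 0 < v by exact: lt_le_trans tv.
  rewrite ln_weight1//.
  have gE : gap v t = ln v - ln t.
    by rewrite /gap ger0_norm// subr_ge0 ler_ln ?posrE.
  have := hr _ _ v0 t0; rewrite ler_norml => /andP[h _].
  have hX : delta / 2 * gap v t - (cr + cs) <= - (ln u - ln (rho v)).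
    by rewrite gE in h *; lra.
  have k0 : 0 < 1 - theta by lra.
  have k1 : 1 - theta < 1 by lra.
  have := key v _ _ k0 e2 hX k1; rewrite normrN.
  have := hy _ _ u0 (rho_gt0 v0); rewrite gapX; lra.
Qed.

End weights.

(** * The defining quasi-norms written with [du/u] *)

Section norms_as_Llog.
Context (R : realType).
Local Notation pos := [set` `]0%R, +oo[%R].

Lemma eq_Lq (q : \bar R) (I : set R) (f g : R -> \bar R) :
  (forall u, I u -> f u = g u) -> Lq q I f = Lq q I g.
Proof.
move=> fg; rewrite /Lq; congr Lnorm; apply/funext => u; rewrite /patch.
by case: ifPn => // /set_mem; exact: fg.
Qed.

Lemma ratio_normE (r : \bar R) (b a : R -> R) (I : set R) :
  ratio_norm r b a I = Llog r I (EFin \o (fun t => b t / a t)).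
Proof. by apply: eq_Lq => u _; rewrite EFinM. Qed.

Lemma KweightedE (E : lmodType R) (X0 X1 : qspace E) (s : R) (q : \bar R)
    (b : R -> R) (I : set R) (f : E) : I `<=` pos ->
  Kweighted X0 X1 s q b I f =
  Llog q I (fun u => (expR (- (s * ln u)) * b u)%:E * Kfun X0 X1 u f)%E.
Proof.
move=> I0; apply: eq_Lq => u /I0; rewrite /= in_itv /= andbT => u0.
rewrite muleA -EFinM; congr (_%:E * _)%E.
rewrite mulrA; congr (_ * _).
rewrite addrC powRD; last by rewrite (gt_eqF u0) implybT.
by rewrite [X in _ * X]/powR gt_eqF// mulNr.
Qed.

Lemma RfunctionalE (E : lmodType R) (X0 X1 : qspace E) (s : R) (r : \bar R)
    (b : R -> R) (q : \bar R) (a : R -> R) (f : E) :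
  Rfunctional X0 X1 s r b q a f =
  Rnorm s r (fun t => b t / a t) q a (fun u => Kfun X0 X1 u f).
Proof.
apply: eq_Lq => x; rewrite /= in_itv /= andbT => x0.
rewrite EFinM -muleA KweightedE//.
by move=> u /=; rewrite !in_itv /= !andbT; exact: lt_trans.
Qed.

End norms_as_Llog.

(** * Membership in the R-spaces and pointwise bounds on K *)

Section Rspace_bounds.
Context (R : realType) (E : topologicalLmodType R) (A0 A1 : qspace E).
Hypothesis cc : compatible_couple A0 A1.
Variables (s : R) (r q : \bar R) (b a : R -> R).
Hypotheses (r0 : (0 < r)%E) (q0 : (0 < q)%E) (sb : slow b) (sa : slow a).
Hypothesis fin1 : (ratio_norm r b a `]0%R, 1%R[ < +oo)%E.
Local Notation k t f := (fine (Kfun A0 A1 t f)).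
Local Notation sumA := (sum_carrier A0 A1).
Local Notation Y := (Rspace A0 A1 s r b q a).
Local Notation w := (fun t => b t / a t).
Local Notation c := (fun t => a t * initial_norm r w t).

Let n0 := qb_ge0 (cc_banach0 cc).
Let n1 := qb_ge0 (cc_banach1 cc).
Let sw : slow w. Proof. exact: slow_div. Qed.
Let w1 : (Llog r [set` `]0%R, 1%R[] (EFin \o w) < +oo)%E.
Proof. by rewrite -ratio_normE. Qed.

Lemma slow_R_weight : slow c.
Proof. by apply: slow_mul => //; exact: initial_norm_slow. Qed.

Lemma Rfunctional_ge0 f : (0 <= Rfunctional A0 A1 s r b q a f)%E.
Proof. exact: Lq_ge0. Qed.

Lemma qnorm_Rspace_ge0 f : carrier Y f -> 0 <= qnorm Y f.
Proof. by move=> _; rewrite fine_ge0// Rfunctional_ge0. Qed.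

Lemma Rspace_le (e : R) : 0 < e -> exists2 C, 0 < C &
  forall t f S, 0 < t -> 0 <= S -> sumA f ->
  (forall u, 0 < u -> k u f <= S * expR (s * ln u - ln (c u) - e * gap u t)) ->
  carrier Y f /\ qnorm Y f <= C * S.
Proof.
move=> e0; have [C C0 hC] := Rnorm_le s r0 q0 sw sa w1 e0.
exists C => // t f S t0 S0 hf kS.
have h : (Rfunctional A0 A1 s r b q a f <= (C * S)%:E)%E.
  rewrite RfunctionalE; apply: (hC t) => // u u0.
    by apply: Kfun_ge0 => //; exact: ltW.
  by rewrite (Kfun_fin n0 n1 (ltW u0) hf) lee_fin kS.
have fin : (Rfunctional A0 A1 s r b q a f < +oo)%E.
  by apply: le_lt_trans h _; exact: ltry.
split=> //; rewrite -lee_fin /= fineK// ge0_fin_numE//; exact: Rfunctional_ge0.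
Qed.

Lemma Rspace_ge : exists2 C, 0 < C & forall t f, 0 < t -> carrier Y f ->
  k t f <= C * expR (s * ln t - ln (c t)) * qnorm Y f.
Proof.
have [C C0 hC] := Rnorm_ge s r0 q0 sw sa w1.
exists C => // t f t0 [hf fin].
have ct0 : 0 < c t by exact: slow_R_weight.1.
have kt0 : 0 <= k t f by apply: fine_Kfun_ge0 => //; exact: ltW.
have h1 u : 0 < u -> (0 <= Kfun A0 A1 u f)%E.
  by move=> u0; apply: Kfun_ge0 => //; exact: ltW.
have h2 u : t <= u -> ((k t f)%:E <= Kfun A0 A1 u f)%E.
  move=> tu; rewrite -(Kfun_fin n0 n1 (ltW t0) hf).
  by apply: Kfun_homo => //; exact: ltW.
have := hC t _ _ t0 kt0 h1 h2; rewrite -RfunctionalE.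
have -> : Rfunctional A0 A1 s r b q a f = (qnorm Y f)%:E.
  by rewrite /= fineK// ge0_fin_numE// Rfunctional_ge0.
rewrite -EFinM lee_fin => h.
have x0 : 0 < expR (s * ln t - ln (c t)) by exact: expR_gt0.
rewrite mulrAC -ler_pdivrMr//; apply: le_trans h.
rewrite expRD !expRN lnK ?posrE// invfM invrK.
by rewrite mulrC.
Qed.

End Rspace_bounds.

(** * The two embeddings *)

Section reiteration.
Context (R : realType) (E : topologicalLmodType R) (A0 A1 : qspace E).
Hypothesis cc : compatible_couple A0 A1.
Variables (theta0 theta1 theta : R) (r r0 r1 q0 q1 : \bar R).
Variables (a a0 a1 b0 b1 : R -> R).
Hypotheses (th0 : 0 < theta0) (th01 : theta0 < theta1) (th1 : theta1 < 1).
Hypotheses (th_gt0 : 0 < theta) (th_lt1 : theta < 1).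
Hypotheses (r_gt0 : (0 < r)%E) (r0_gt0 : (0 < r0)%E) (r1_gt0 : (0 < r1)%E).
Hypotheses (q0_gt0 : (0 < q0)%E) (q1_gt0 : (0 < q1)%E).
Hypotheses (sa : slow a) (sa0 : slow a0) (sa1 : slow a1).
Hypotheses (sb0 : slow b0) (sb1 : slow b1).
Hypothesis fin0 : (ratio_norm r0 b0 a0 `]0%R, 1%R[ < +oo)%E.
Hypothesis fin1 : (ratio_norm r1 b1 a1 `]0%R, 1%R[ < +oo)%E.

Local Notation pos := [set` `]0%R, +oo[%R].
Local Notation c0 := (fun t => a0 t * initial_norm r0 (fun t => b0 t / a0 t) t).
Local Notation c1 := (fun t => a1 t * initial_norm r1 (fun t => b1 t / a1 t) t).
Local Notation rh := (rho theta0 theta1 c0 c1).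
Local Notation wt := (weight theta0 theta1 theta a c0 c1).
Local Notation eta := ((1 - theta) * theta0 + theta * theta1).
Local Notation Y0 := (Rspace A0 A1 theta0 r0 b0 q0 a0).
Local Notation Y1 := (Rspace A0 A1 theta1 r1 b1 q1 a1).
Local Notation k t f := (fine (Kfun A0 A1 t f)).
Local Notation sumA := (sum_carrier A0 A1).
Local Notation kY t f := (fine (Kfun Y0 Y1 t f)).
Local Notation sumY := (sum_carrier Y0 Y1).

Let n0 := qb_ge0 (cc_banach0 cc).
Let n1 := qb_ge0 (cc_banach1 cc).
Let sc0 : slow c0. Proof. exact: slow_R_weight. Qed.
Let sc1 : slow c1. Proof. exact: slow_R_weight. Qed.
Let rh_gt0 t : 0 < t -> 0 < rh t. Proof. exact: rho_gt0. Qed.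
Let wt_gt0 t : 0 < t -> 0 < wt t. Proof. exact: weight_gt0. Qed.
Let nY0 f : carrier Y0 f -> 0 <= qnorm Y0 f. Proof. exact: qnorm_Rspace_ge0. Qed.
Let nY1 f : carrier Y1 f -> 0 <= qnorm Y1 f. Proof. exact: qnorm_Rspace_ge0. Qed.

Definition wKA (f : E) (t : R) : R := wt t * k t f.
Definition wKY (f : E) (t : R) : R := expR (- (theta * ln t)) * a t * kY t f.

Lemma sumY_sumA f : sumY f -> sumA f.
Proof. by move=> [f0 [f1 [[h0 _] [h1 _] ->]]]; apply: sum_carrierD. Qed.

Lemma wKA_ge0 f t : 0 < t -> 0 <= wKA f t.
Proof.
by move=> t0; rewrite mulr_ge0 ?(ltW (wt_gt0 t0))// fine_Kfun_ge0// ltW.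
Qed.

Lemma wKY_ge0 f t : 0 < t -> 0 <= wKY f t.
Proof.
move=> t0; rewrite !mulr_ge0 ?expR_ge0//; first exact/ltW/sa.1.
by apply: fine_Kfun_ge0 => //; exact: ltW.
Qed.

Lemma Kweighted_A f : sumA f ->
  Kweighted A0 A1 eta r (asharp theta0 theta1 theta a c0 c1) pos f =
  Llog r pos (EFin \o wKA f).
Proof.
move=> hf; rewrite KweightedE//; apply: eq_Lq => u; rewrite /= in_itv /= andbT => u0.
by rewrite (Kfun_fin n0 n1 (ltW u0) hf).
Qed.

Lemma Kweighted_Y f : sumY f ->
  Kweighted Y0 Y1 theta r a pos f = Llog r pos (EFin \o wKY f).
Proof.
move=> hf; rewrite KweightedE//; apply: eq_Lq => u; rewrite /= in_itv /= andbT => u0.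
by rewrite (Kfun_fin nY0 nY1 (ltW u0) hf).
Qed.

Lemma wKA_reg : exists2 C, 0 < C & forall f s t, sumA f -> 0 < s -> 0 < t ->
  gap s t <= ln 2 -> wKA f s <= C * wKA f t.
Proof.
have [c c_ge0 hc] := weight_reg th0 th01 th_gt0 sa sc0 sc1.
exists (expR (c + ln 2)); first exact: expR_gt0.
move=> f s t hf s0 t0 st; rewrite /wKA.
have kt0 : 0 <= k t f by apply: fine_Kfun_ge0 => //; exact: ltW.
have h1 : wt s <= expR c * wt t.
  rewrite -(@lnK _ (wt s)) ?posrE ?wt_gt0// -(@lnK _ (wt t)) ?posrE ?wt_gt0//.
  by rewrite -expRD ler_expR addrC hc.
have h2 : k s f <= expR (ln 2) * k t f.
  apply: (le_trans (fine_Kfun_gap n0 n1 s0 t0 hf)); apply: ler_wpM2r => //.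
  by rewrite ler_expR.
rewrite expRD mulrACA; apply: ler_pM => //; first exact/ltW/wt_gt0.
by apply: fine_Kfun_ge0 => //; exact: ltW.
Qed.

Lemma wKY_reg : exists2 C, 0 < C & forall f s t, sumY f -> 0 < s -> 0 < t ->
  gap s t <= ln 2 -> wKY f s <= C * wKY f t.
Proof.
have [c hc] := sa.2 _ ltr01.
exists (expR (theta * ln 2 + ln 2 + c + ln 2)); first exact: expR_gt0.
move=> f s t hf s0 t0 st; rewrite /wKY.
have kt0 : 0 <= kY t f by apply: fine_Kfun_ge0 => //; exact: ltW.
have h1 : expR (- (theta * ln s)) * a s <=
    expR (theta * ln 2 + ln 2 + c) * (expR (- (theta * ln t)) * a t).
  rewrite -{1}(@lnK _ (a s)) ?posrE ?sa.1// -{1}(@lnK _ (a t)) ?posrE ?sa.1//.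
  rewrite -!expRD ler_expR.
  have := hc _ _ s0 t0.
  have : theta * (ln t - ln s) <= theta * ln 2.
    rewrite ler_pM2l//; apply: le_trans st; rewrite gapC; exact: ler_norm.
  lra.
have h2 : kY s f <= expR (ln 2) * kY t f.
  apply: (le_trans (fine_Kfun_gap nY0 nY1 s0 t0 hf)); apply: ler_wpM2r => //.
  by rewrite ler_expR.
rewrite expRD mulrACA; apply: ler_pM => //.
  by rewrite mulr_ge0 ?expR_ge0// ltW ?sa.1.
by apply: fine_Kfun_ge0 => //; exact: ltW.
Qed.

Lemma wKA_le_wKY : exists2 C, 0 < C & forall f t, 0 < t -> sumY f ->
  wKA f t <= C * wKY f (rh t).
Proof.
have [C C0 hC] := Kfun_add cc.
have [D0 D00 hD0] := Rspace_ge cc theta0 r0_gt0 q0_gt0 sb0 sa0 fin0.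
have [D1 D10 hD1] := Rspace_ge cc theta1 r1_gt0 q1_gt0 sb1 sa1 fin1.
exists (C * (D0 + D1)); first by rewrite mulr_gt0// addr_gt0.
move=> f t t0 hf; have rt0 := rh_gt0 t0.
have Kfin := Kfun_fin nY0 nY1 (ltW rt0) hf.
pose x := expR (theta0 * ln t - ln (c0 t)).
have x0 : 0 < x by exact: expR_gt0.
(* This identity dictates [rho]: both pointwise bounds share the factor [x], and their sum is the
   expression minimized by the K-functional of the R-spaces at [rh t]. *)
have xE : expR (theta1 * ln t - ln (c1 t)) = x * rh t.
  rewrite /x -[in RHS](@lnK _ (rh t)) ?posrE// -expRD; congr expR.
  rewrite ln_rho//; ring.
have main : ((k t f / (C * (D0 + D1) * x))%:E <= Kfun Y0 Y1 (rh t) f)%E.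
  apply: le_ereal_inf_tmp => _ [f0 [f1 [h0 h1 fE ->]]].
  rewrite lee_fin ler_pdivrMr ?mulr_gt0 ?addr_gt0// fE.
  apply: (le_trans (hC _ _ _ t0 h0.1 h1.1)).
  rewrite [leRHS]mulrC -2!mulrA ler_pM2l//.
  have m0 := hD0 _ _ t0 h0; have m1 := hD1 _ _ t0 h1.
  rewrite xE in m1; rewrite -/x in m0.
  have p0 := nY0 h0; have p1 := nY1 h1.
  have z0 : 0 <= D1 * x * qnorm Y0 f0 by rewrite !mulr_ge0// ltW.
  have z1 : 0 <= D0 * x * (rh t * qnorm Y1 f1).
    by apply: mulr_ge0; apply: mulr_ge0; rewrite ?(ltW D00) ?(ltW x0) ?(ltW rt0) ?p1.
  lra.
move: main; rewrite Kfin lee_fin ler_pdivrMr ?mulr_gt0 ?addr_gt0// => main.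
rewrite /wKA /wKY; apply: (le_trans (ler_wpM2l (ltW (wt_gt0 t0)) main)).
have e1 : wt t * x = expR (- (theta * ln (rh t))) * a (rh t).
  rewrite /x -[wt t]lnK ?posrE ?wt_gt0// -(@lnK _ (a (rh t))) ?posrE ?sa.1//.
  rewrite -!expRD; congr expR; rewrite ln_weight0//; ring.
rewrite -e1 [leRHS](_ : _ = wt t * (kY (rh t) f * (C * (D0 + D1) * x)))//; ring.
Qed.

Lemma decomposition_in_R_spaces : exists e C, [/\ 0 < e, 0 < C &
  forall f u B, sumA f -> 0 < u -> 0 <= B ->
  (forall n, wKA f (grid R n) * expR (- (e * gap u (rh (grid R n)))) <= B) ->
  exists f0 f1, [/\ carrier Y0 f0, carrier Y1 f1, f = f0 + f1 &
    expR (- (theta * ln u)) * a u * (qnorm Y0 f0 + u * qnorm Y1 f1) <= C * B]].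
Proof.
have [e [e_gt0 e1 e2]] : exists e, [/\ 0 < e, e <= theta / 4 & e <= (1 - theta) / 4].
  exists (Num.min (theta / 4) ((1 - theta) / 4)).
  by rewrite lt_min !divr_gt0 ?subr_gt0// !ge_min !lexx orbT.
have d_gt0 : 0 < theta1 - theta0 by rewrite subr_gt0.
have td : 0 < theta * (theta1 - theta0) / 4 by rewrite divr_gt0// mulr_gt0.
have td' : 0 < (1 - theta) * (theta1 - theta0) / 4.
  by rewrite divr_gt0// mulr_gt0// subr_gt0.
have t02 : 0 < theta0 / 2 by rewrite divr_gt0.
have t12 : 0 < (1 - theta1) / 2 by rewrite divr_gt0// subr_gt0.
(* One decay rate for both parts on both sides of [t]. The first two bounds are the rates of
   [weight_decay]. For [f0] beyond [t] the power [theta0] gives the decay, for [f1] below [t] the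
   power [1 - theta1]; half of each pays for the variation of [c0] or [c1]. *)
have [x [x_gt0 x1 x2 x3 x4]] : exists x, [/\ 0 < x,
    x <= theta * (theta1 - theta0) / 4, x <= (1 - theta) * (theta1 - theta0) / 4,
    x <= theta0 / 2 & x <= (1 - theta1) / 2].
  exists (Num.min (Num.min (theta * (theta1 - theta0) / 4)
    ((1 - theta) * (theta1 - theta0) / 4)) (Num.min (theta0 / 2) ((1 - theta1) / 2))).
  by rewrite !lt_min td td' t02 t12 !ge_min !lexx ?orbT.
have [C0 C00 hC0] := Rspace_le cc theta0 r0_gt0 q0_gt0 sb0 sa0 fin0 x_gt0.
have [C1 C10 hC1] := Rspace_le cc theta1 r1_gt0 q1_gt0 sb1 sa1 fin1 x_gt0.
have [CK CK0 hCK] := Kfun_decomposition cc.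
have [cw cw0 hcw] := weight_reg th0 th01 th_gt0 sa sc0 sc1.
have [cr cr0 hcr] := rho_gap th01 sc0 sc1.
have [M M0 hM] := weight_decay th01 th_gt0 th_lt1 sa sc0 sc1 e_gt0 e1 e2.
have [l0 hl0] := sc0.2 _ t02; have [l1 hl1] := sc1.2 _ t12.
have l0_ge0 : 0 <= l0 by have := hl0 _ _ ltr01 ltr01; rewrite gapxx; lra.
have l1_ge0 : 0 <= l1 by have := hl1 _ _ ltr01 ltr01; rewrite gapxx; lra.
(* [G] bounds the displacement of [rho] within one grid cell. [N] collects the cost of moving from
   [v] to its grid point: [cw] for the weight, [ln 2] for K, [e * G] for the kernel. *)
pose G := 3 / 2 * (theta1 - theta0) * ln 2 + cr.
pose N := cw + ln 2 + e * G.
pose P := N + M + l0 + l1.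
exists e, (CK * expR P * (C0 + C1)); split=> //.
  by rewrite !mulr_gt0 ?expR_gt0// addr_gt0.
move=> f u B hf u0 B0 hB.
have [t t0 [ht0 ht1]] := hM _ u0.
have [f0 [f1 [h0 h1 fE hk]]] := hCK _ _ t0 hf.
have kB v : 0 < v -> k v f <= B * expR (N + (e * gap u (rh v) - ln (wt v))).
  move=> v0; have [n /andP[n1' n2]] := grid_cover v0.
  have g0 := grid_gt0 R n.
  have gv : gap v (grid R n) <= ln 2 by rewrite gapC; apply: gap_double => //; exact: ltW.
  apply: (le_trans (fine_Kfun_gap n0 n1 v0 g0 hf)).
  have := hB n; rewrite /wKA mulrAC -ler_pdivlMl; last first.
    by rewrite mulr_gt0 ?expR_gt0 ?wt_gt0.
  rewrite -{1}(@lnK _ (wt (grid R n))) ?posrE ?wt_gt0// -expRD -expRN.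
  move=> h; apply: (le_trans (ler_wpM2l (expR_ge0 _) h)).
  rewrite mulrA -expRD mulrC; apply: ler_wpM2l => //; rewrite ler_expR.
  have hw := hcw _ _ v0 g0 gv.
  have tri := gap_triangle u (rh v) (rh (grid R n)).
  have hr := hcr _ _ v0 g0.
  have hr' : gap u (rh (grid R n)) <= gap u (rh v) + G.
    have : 3 / 2 * (theta1 - theta0) * gap v (grid R n) <= 3 / 2 * (theta1 - theta0) * ln 2.
      by rewrite ler_pM2l// mulr_gt0.
    rewrite /G; lra.
  have : e * gap u (rh (grid R n)) <= e * (gap u (rh v) + G) by rewrite ler_pM2l.
  rewrite /N; lra.
have gvt v : 0 <= gap v t by exact: gap_ge0.
have lec v z : x <= z -> x * gap v t <= z * gap v t by move=> xz; apply: ler_wpM2r.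
pose Q0 := theta * ln u - ln (a u).
pose Q1 := (theta - 1) * ln u - ln (a u).
have step z y w (e' : R) : 0 <= B -> z <= CK * y -> y <= B * expR w ->
    w <= e' -> z <= CK * B * expR e'.
  move=> _ zy yB we; apply: (le_trans zy); rewrite -mulrA ler_pM2l//.
  apply: (le_trans yB); apply: ler_wpM2l => //; by rewrite ler_expR.
have bd0 v : 0 < v -> k v f0 <=
    (CK * B * expR (P + Q0)) * expR (theta0 * ln v - ln (c0 v) - x * gap v t).
  move=> v0; rewrite -mulrA -expRD.
  have [hk1 hk2 _ _] := hk _ v0.
  have [vt|/ltW tv] := leP v t.
    apply: (step _ _ _ _ B0 hk1 (kB _ v0)).
    have := ht0 _ v0 vt; have := lec v _ x1; rewrite /P /Q0; lra.
  apply: (step _ _ _ _ B0 hk2 (kB _ t0)).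
  have := ht0 _ t0 (lexx t); rewrite gapxx.
  have gE : gap v t = ln v - ln t.
    by rewrite /gap ger0_norm// subr_ge0 ler_ln ?posrE.
  have := hl0 _ _ v0 t0; have := lec v _ x3; rewrite /P /Q0 gE; lra.
have bd1 v : 0 < v -> k v f1 <=
    (CK * B * expR (P + Q1)) * expR (theta1 * ln v - ln (c1 v) - x * gap v t).
  move=> v0; rewrite -mulrA -expRD.
  have [_ _ hk1 hk2] := hk _ v0.
  have [tv|/ltW vt] := leP t v.
    apply: (step _ _ _ _ B0 hk1 (kB _ v0)).
    have := ht1 _ tv; have := lec v _ x2; rewrite /P /Q1; lra.
  have gE : gap v t = ln t - ln v.
    by rewrite gapC /gap ger0_norm// subr_ge0 ler_ln ?posrE.
  have kv : v / t * k t f <= B * expR (N + (e * gap u (rh t) - ln (wt t)) - gap v t).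
    rewrite gE opprB (expRD (N + _)) (expRD (ln v)) expRN !lnK ?posrE//.
    have vt0 : 0 <= v / t by rewrite divr_ge0// ltW.
    apply: (le_trans (ler_wpM2l vt0 (kB _ t0))).
    by rewrite [leRHS]mulrA [leRHS]mulrC.
  apply: (step _ _ _ _ B0 hk2 kv).
  have := ht1 _ (lexx t); rewrite gapxx.
  have := hl1 _ _ v0 t0; have := lec v _ x4; rewrite /P /Q1 gE; lra.
have S0 : 0 <= CK * B * expR (P + Q0) by rewrite !mulr_ge0 ?expR_ge0// ltW.
have S1 : 0 <= CK * B * expR (P + Q1) by rewrite !mulr_ge0 ?expR_ge0// ltW.
have [y0 m0] := hC0 _ _ _ t0 S0 (sum_carrier0 cc h0) bd0.
have [y1 m1] := hC1 _ _ _ t0 S1 (sum_carrier1 cc h1) bd1.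
exists f0, f1; split=> //.
have au := sa.1 _ u0.
rewrite -{1}(@lnK _ (a u)) ?posrE// -expRD.
(* [Q0] and [Q1] differ by [ln u], so the factor [u] brings both norms to the same size. *)
have um1 : u * qnorm Y1 f1 <= C1 * (CK * B * expR (P + Q0)).
  apply: (le_trans (ler_wpM2l (ltW u0) m1)).
  rewrite -{1}(@lnK _ u) ?posrE//.
  rewrite [leLHS](_ : _ = C1 * (CK * B * (expR (ln u) * expR (P + Q1)))); last by ring.
  rewrite -expRD (_ : ln u + (P + Q1) = P + Q0)//.
  by rewrite /Q0 /Q1; ring.
apply: (@le_trans _ _ (expR (- (theta * ln u) + ln (a u)) *
    ((C0 + C1) * (CK * B * expR (P + Q0))))).
  by rewrite ler_pM2l ?expR_gt0//; lra.
rewrite [leLHS](_ : _ = (C0 + C1) * (CK * B *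
    (expR (- (theta * ln u) + ln (a u)) * expR (P + Q0)))); last by ring.
rewrite -expRD (_ : _ + (P + Q0) = P); last by rewrite /Q0; ring.
rewrite [leRHS](_ : _ = (C0 + C1) * (CK * B * expR P))//; ring.
Qed.

Lemma A_embeds_in_Y : exists2 C, 0 < C & forall f, sumA f ->
  (Llog r pos (EFin \o wKA f) < +oo)%E ->
  sumY f /\ (Llog r pos (EFin \o wKY f) <= C%:E * Llog r pos (EFin \o wKA f))%E.
Proof.
have [C1 C10 h1] := wKA_reg.
have [e [C2 [e0 C20 h2]]] := decomposition_in_R_spaces.
have [C3 C30 h3] := Llog_lower_bound r_gt0.
have C120 : 0 < C1 + C2 by rewrite addr_gt0.
have [C C0 h] := Llog_transfer r_gt0 e0 C120.
exists C => // f hf fin.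
have hA0 u : pos u -> (0 <= (EFin \o wKA f) u)%E.
  by rewrite /= in_itv /= andbT lee_fin; exact: wKA_ge0.
pose L := fine (Llog r pos (EFin \o wKA f)).
have LE : Llog r pos (EFin \o wKA f) = L%:E by rewrite fineK// ge0_fin_numE// Llog_ge0.
have L0 : 0 <= L by rewrite -lee_fin -LE Llog_ge0.
have hAL t : 0 < t -> wKA f t <= C1 * (C3 * L).
  move=> t0; rewrite -ler_pdivrMl// -lee_fin [leRHS]EFinM -LE.
  apply: (h3 t) => //.
    by move=> x /=; rewrite !in_itv /= andbT => /andP[tx _]; exact: lt_trans tx.
  move=> u /andP[tu u2]; have u0 : 0 < u by exact: lt_trans tu.
  rewrite lee_fin ler_pdivrMl//; apply: h1 => //.
  by apply: gap_double => //; exact: ltW.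
(* Membership comes first, since [fine] would turn an infinite K-functional into 0. A decomposition
   at the single point [u = 1] is enough, and finiteness of the norm provides its bound. *)
have sY : sumY f.
  have B0 : 0 <= C1 * (C3 * L) by rewrite !mulr_ge0// ltW.
  have hB n : wKA f (grid R n) * expR (- (e * gap 1 (rh (grid R n)))) <= C1 * (C3 * L).
    apply: le_trans (hAL _ (grid_gt0 R n)).
    apply: ler_piMr; first exact/wKA_ge0/grid_gt0.
    by rewrite expR_le1 oppr_le0 mulr_ge0 ?gap_ge0// ltW.
  have [f0 [f1 [y0 y1 fE _]]] := h2 _ _ _ hf ltr01 B0 hB.
  by exists f0, f1.
split=> //; apply: (h (fun n => rh (grid R n))); split.
- exact: wKY_ge0.
- exact: wKA_ge0.
- by move=> n; exact/rh_gt0/grid_gt0.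
- move=> v v' v0 vv' v'2; have v'0 : 0 < v' by exact: lt_le_trans vv'.
  apply: (@le_trans _ _ (C1 * wKA f v')); first exact/h1/gap_double.
  by apply: ler_wpM2r; [exact: wKA_ge0|rewrite lerDl ltW].
- move=> u B u0 B0 hB.
  have [f0 [f1 [y0 y1 fE hle]]] := h2 _ _ _ hf u0 B0 hB.
  apply: (@le_trans _ _ (C2 * B)); last first.
    by apply: ler_wpM2r => //; rewrite lerDr ltW.
  apply: le_trans hle; rewrite /wKY; apply: ler_wpM2l.
    by rewrite mulr_ge0 ?expR_ge0// ltW// sa.1.
  rewrite -lee_fin -(Kfun_fin nY0 nY1 (ltW u0) sY) {1}fE.
  exact: Kfun_le.
Qed.

Lemma Y_embeds_in_A : exists2 C, 0 < C & forall f, sumY f ->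
  (Llog r pos (EFin \o wKA f) <= C%:E * Llog r pos (EFin \o wKY f))%E.
Proof.
have [C1 C10 h1] := wKY_reg.
have [C2 C20 h2] := wKA_le_wKY.
have [g g0 hg] := rho_gap_ge th01 sc0 sc1.
pose d := (theta1 - theta0) / 2.
have d0 : 0 < d by rewrite divr_gt0// subr_gt0.
pose D := C1 + C2 * (C1 * expR (ln 2 + g)).
have D0 : 0 < D by rewrite addr_gt0// !mulr_gt0// expR_gt0.
have [C C0 h] := Llog_transfer r_gt0 d0 D0.
exists C => // f hf.
pose cell n t := 0 < t /\ grid R n <= rh t < 2 * grid R n.
(* A representative of the preimage under [rho] of the [n]-th grid cell. Cells missed by [rho] get
   the default 1, which is harmless: the bound at [t] is read only at the cell containing [rh t]. *)
pose tau n := xget 1 [set t | cell n t].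
have tauP n t : cell n t -> cell n (tau n).
  move=> ht; exact: (xgetPex 1 (ex_intro (fun t => cell n t) t ht)).
apply: (h tau); split.
- exact: wKA_ge0.
- exact: wKY_ge0.
- move=> n; rewrite /tau; case: xgetP => [x -> [x0 _]|_]; first exact: x0.
  exact: ltr01.
- move=> v v' v0 vv' v'2; have v'0 : 0 < v' by exact: lt_le_trans vv'.
  apply: (@le_trans _ _ (C1 * wKY f v')); first exact/h1/gap_double.
  apply: ler_wpM2r; first exact: wKY_ge0.
  by rewrite lerDl ltW// !mulr_gt0// expR_gt0.
- move=> t B t0 B0 hB; have rt0 := rh_gt0 t0.
  have [n hn] := grid_cover rt0; have gn0 := grid_gt0 R n.
  have [tau0 htau] := tauP n t (conj t0 hn).
  have gg x : grid R n <= x < 2 * grid R n -> gap (grid R n) x <= ln 2.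
    by move=> /andP[x1 x2]; apply: gap_double => //; exact: ltW.
  have gr : gap (rh t) (rh (tau n)) <= ln 2.
    have [/andP[x1 x2] /andP[y1 y2]] := (hn, htau).
    have rtau0 := rh_gt0 tau0.
    by apply: gap_le_ln2 => //; lra.
  (* [rh t] and [rh (tau n)] share a cell, so the lower slope of [rho] keeps [t] near [tau n]; the
     kernel there is bounded below. *)
  have dg : d * gap t (tau n) <= ln 2 + g.
    by apply: (le_trans (hg _ _ t0 tau0)); rewrite lerD2r.
  have b1' : wKY f (rh t) <= C1 * wKY f (grid R n).
    by apply: h1 => //; rewrite gapC; exact: gg.
  have b2' : wKY f (grid R n) <= expR (ln 2 + g) * B.
    have := hB n; rewrite -ler_pdivlMr ?expR_gt0// -expRN opprK => hb.
    apply: (le_trans hb); rewrite mulrC; apply: ler_wpM2r => //.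
    by rewrite ler_expR.
  apply: (le_trans (h2 _ _ t0 hf)).
  apply: (@le_trans _ _ (C2 * (C1 * expR (ln 2 + g)) * B)); last first.
    by apply: ler_wpM2r => //; rewrite /D lerDr ltW.
  rewrite -mulrA ler_pM2l// -mulrA; apply: (le_trans b1').
  by rewrite ler_pM2l.
Qed.

Lemma reiteration_R_spaces :
  same_space (Kspace Y0 Y1 theta r a)
    (Kspace A0 A1 eta r (asharp theta0 theta1 theta a c0 c1)).
Proof.
have [C C0 hC] := A_embeds_in_Y; have [D D0 hD] := Y_embeds_in_A.
have YA f : carrier (Kspace Y0 Y1 theta r a) f ->
    carrier (Kspace A0 A1 eta r (asharp theta0 theta1 theta a c0 c1)) f.
  move=> [hf]; rewrite Kweighted_Y// => fin; have wKA' := sumY_sumA hf.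
  split=> //; rewrite Kweighted_A//; apply: le_lt_trans (hD _ hf) _.
  by apply: lte_mul_pinfty => //; rewrite lee_fin ltW.
have AY f : carrier (Kspace A0 A1 eta r (asharp theta0 theta1 theta a c0 c1)) f ->
    carrier (Kspace Y0 Y1 theta r a) f.
  move=> [hf]; rewrite Kweighted_A// => fin.
  have [wKY' le] := hC _ hf fin.
  split=> //; rewrite Kweighted_Y//; apply: le_lt_trans le _.
  by apply: lte_mul_pinfty => //; rewrite lee_fin ltW.
split; first by apply/seteqP; split=> f; [exact: YA|exact: AY].
exists (C + D); first by rewrite addr_gt0.
move=> f hf; have hf' := YA _ hf.
case: hf => sY finY; case: hf' => sA finA.
rewrite /= Kweighted_Y// Kweighted_A//.
rewrite Kweighted_Y// in finY; rewrite Kweighted_A// in finA.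
have [_ le1] := hC _ sA finA; have le2 := hD _ sY.
have nA : Llog r pos (EFin \o wKA f) \is a fin_num by rewrite ge0_fin_numE ?Llog_ge0.
have nY : Llog r pos (EFin \o wKY f) \is a fin_num by rewrite ge0_fin_numE ?Llog_ge0.
split; rewrite -lee_fin EFinM !fineK//.
  apply: (le_trans le1); apply: lee_wpmul2r; first exact: Llog_ge0.
  by rewrite lee_fin lerDl ltW.
apply: (le_trans le2); apply: lee_wpmul2r; first exact: Llog_ge0.
by rewrite lee_fin lerDr ltW.
Qed.

End reiteration.

Theorem theorem27 (R : realType) (E : topologicalLmodType R) (A0 A1 : qspace E)
  (theta0 theta1 theta : R) (r r0 r1 q0 q1 : \bar R)
  (a a0 a1 b0 b1 : R -> R) :
  compatible_couple A0 A1 ->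
  carrier A0 `&` carrier A1 <> [set 0] ->
  0 < theta0 -> theta0 < theta1 -> theta1 < 1 ->
  0 < theta -> theta < 1 ->
  (0 < r)%E -> (0 < r0)%E -> (0 < r1)%E -> (0 < q0)%E -> (0 < q1)%E ->
  SV a -> SV a0 -> SV a1 -> SV b0 -> SV b1 ->
  (ratio_norm r0 b0 a0 `]0%R, 1%R[ < +oo)%E ->
  (ratio_norm r1 b1 a1 `]0%R, 1%R[ < +oo)%E ->
  let c0 := fun t : R => a0 t * fine (ratio_norm r0 b0 a0 `]0, t[) in
  let c1 := fun t : R => a1 t * fine (ratio_norm r1 b1 a1 `]0, t[) in
  let rho := fun t : R => t `^ (theta1 - theta0) * (c0 t / c1 t) in
  let eta := (1 - theta) * theta0 + theta * theta1 in
  let asharp := fun t : R => c0 t `^ (1 - theta) * c1 t `^ theta * a (rho t) in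
  same_space
    (Kspace (Rspace A0 A1 theta0 r0 b0 q0 a0) (Rspace A0 A1 theta1 r1 b1 q1 a1)
       theta r a)
    (Kspace A0 A1 eta r asharp).
Proof.
move=> cc _ t0 t01 t1 t_gt0 t_lt1 hr hr0 hr1 hq0 hq1.
move=> /SV_slow sa /SV_slow sa0 /SV_slow sa1 /SV_slow sb0 /SV_slow sb1 fin0 fin1.
have cE b' a' q : (fun t => a' t * fine (ratio_norm q b' a' [set` `]0, t[])) =
    (fun t : R => a' t * initial_norm q (fun t => b' t / a' t) t).
  by apply/funext => t; rewrite ratio_normE.
move=> c0 c1 rho' eta asharp'; rewrite /asharp' /rho' /c0 /c1 {asharp' rho' c0 c1}.
have := reiteration_R_spaces cc t0 t01 t1 t_gt0 t_lt1 hr hr0 hr1 hq0 hq1 sa sa0 sa1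
  sb0 sb1 fin0 fin1.
rewrite -!cE; exact.
Qed.
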